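(* Consider the resource allocation problem $$\min_{y\in\mathbb{R}^{Nn}} \sum_{i=1}^N f_i(y_i)\quad\text{subject to}\quad \sum_{i=1}^N y_i=\sum_{i=1}^N d_i,\quad y_i\in\Omega_i,\ i=1,\dots,N, \qquad (P)$$ with $y=\mathrm{col}(y_1,\dots,y_N)$, $d_i\in\mathbb{R}^n$, and each $\Omega_i\subset\mathbb{R}^n$ closed and convex. Suppose Slater's condition holds (there exist $z_i$ in the relative interior of $\Omega_i$, $i=1,\dots,N$, with $\sum_i z_i=\sum_i d_i$), each $f_i$ is convex and locally Lipschitz continuous, and each $f_i$ is $\omega$-strongly convex on $\Omega_i$ for some $\omega>0$. Suppose the communication graph is a connected undirected graph with Laplacian $L$, let $\lambda_2$ be the smallest positive eigenvalue of $L$, and let $$k_1>\frac{\|L\|^2}{\lambda_2^2\,\omega},\qquad k_2>\frac{k_1^2\|L\|^2}{\lambda_2^3},\qquad k_3>0 .$$ Consider the algorithm, for $i=1,\dots,N$, $$\begin{cases}\dot x_i\in y_i-x_i-\partial f_i(y_i)+s_i\\ \dot s_i=k_1(w_i^L-y_i+d_i)+k_2\sum_{j=1}^N a_{ij}(s_j-s_i)\\ \dot w_i=k_3\sum_{j=1}^N a_{ij}\big((w_j^L-y_j+d_j)-(w_i^L-y_i+d_i)\big)\\ y_i=P_{\Omega_i}(x_i),\end{cases}\qquad w_i^L=\sum_{j=1}^N a_{ij}(w_i-w_j).$$ Then the algorithm converges asymptotically to the optimal solution of $(P)$: for every solution (with arbitrary initial point), $\lim_{t\to\infty}y(t)=y^*$,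 where $y^*$ is the optimal solution of $(P)$.
   Context: $N\ge 2$ agents. Each $f_i$ is a (possibly nonsmooth) real-valued function defined on an open convex neighbourhood of $\Omega_i$ (for instance all of $\mathbb{R}^n$), on which it is convex and locally Lipschitz; $\partial f_i$ is the Clarke generalized gradient, which for convex $f_i$ is the convex subdifferential. $f_i$ is $\omega$-strongly convex on $\Omega_i$ if $(p-q)^T(\gamma_p-\gamma_q)\ge\omega\|p-q\|^2$ for all $p,q\in\Omega_i$, $\gamma_p\in\partial f_i(p)$, $\gamma_q\in\partial f_i(q)$. $P_{\Omega}(p)=\arg\min_{q\in\Omega}\|p-q\|$ is the Euclidean projection onto a closed convex set $\Omega$. $\mathrm{col}(\cdot)$ denotes stacking of column vectors, $\|\cdot\|$ the Euclidean norm of vectors and the spectral norm of matrices. The communication graph has nodes $1,\dots,N$ and weighted adjacency matrix $\mathcal{A}=(a_{ij})$ with $a_{ij}\ge0$ and $a_{ij}>0$ iff node $i$ can receive information from node $j$; it is undirected when $a_{ij}=a_{ji}$ for all $i,j$. Its Laplacian is $L=\mathrm{diag}(\sum_j a_{1j},\dots,\sum_j a_{Nj})-\mathcal{A}$, which for a connected undirected graph is positive semidefinite with simple eigenvalue $0$. The variables are $x_i,s_i,w_i\in\mathbb{R}^n$, and $y=\mathrm{col}(y_1,\dots,y_N)$. A solution is a Carathéodory solution on $[0,\infty)$: $(x,s,w)$ is (locally) absolutely continuous and satisfies the inclusion and equations for almost every $t$, with $y_i(t)=P_{\Omega_i}(x_i(t))$. *)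

(* Defs.v *)
From HB Require Import structures.
From mathcomp Require Export all_boot all_order all_algebra.
From mathcomp Require Export all_classical all_reals all_analysis.

Set Implicit Arguments.
Unset Strict Implicit.
Unset Printing Implicit Defensive.

Export Order.TTheory GRing.Theory Num.Theory.
Export numFieldNormedType.Exports.

#[global] Open Scope classical_set_scope.
#[global] Open Scope ring_scope.

Section Euclid.
Variables (R : realType) (n : nat).
Implicit Types (u v p : 'rV[R]_n) (A : set 'rV[R]_n).

(* Vectors of R^n are represented as row vectors.  The library norm `|_| on
   'rV[R]_n is the sup norm, hence a separate Euclidean norm; both induce the
   library topology. *)
Definition dot u v : R := \sum_k u 0 k * v 0 k.

Definition enorm u : R := Num.sqrt (dot u u).

(* Equal to p when no minimizer exists; for A nonempty, closed and convex the
   minimizer exists and is unique. *)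
Definition proj A p : 'rV[R]_n :=
  xget p [set q | A q /\ forall r, A r -> enorm (p - q) <= enorm (p - r)].

Definition affine_hull A : set 'rV[R]_n :=
  [set v | exists m (p : 'I_m -> 'rV[R]_n) (c : 'I_m -> R),
    [/\ forall k, A (p k), \sum_k c k = 1 & v = \sum_k c k *: p k]].

Definition relative_interior A : set 'rV[R]_n :=
  [set v | A v /\ \forall u \near v, affine_hull A u -> A u].

End Euclid.

(* With row vectors, u *m A^T is the transpose of A applied to the column u^T. *)
Definition spectral_norm (R : realType) (m n : nat) (A : 'M[R]_(m, n)) : R :=
  sup [set enorm (u *m A^T) | u in [set u : 'rV[R]_n | enorm u <= 1]].

Section NonsmoothFunctions.
Variables (R : realType) (n : nat).
Implicit Types (f : 'rV[R]_n -> R) (A : set 'rV[R]_n).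

Definition locally_lipschitz_on A f : Prop :=
  forall p, A p -> exists2 V, nbhs p V & [lipschitz f q | q in A `&` V].

(* f°(p; v) = limsup_{q -> p, h -> 0+} (f (q + h v) - f q) / h.  It depends
   only on the values of f near p. *)
Definition clarke_derivative f (p v : 'rV[R]_n) : \bar R :=
  limf_esup (fun z : 'rV[R]_n * R => ((f (z.1 + z.2 *: v) - f z.1) / z.2)%:E)
            (filter_prod (nbhs p) (0^'+)).

Definition clarke_gradient f (p : 'rV[R]_n) : set 'rV[R]_n :=
  [set g | forall v, ((dot g v)%:E <= clarke_derivative f p v)%E].

Definition strongly_convex_on A (omega : R) f : Prop :=
  forall p q gp gq, A p -> A q ->
    clarke_gradient f p gp -> clarke_gradient f q gq ->
    omega * enorm (p - q) ^+ 2 <= dot (p - q) (gp - gq).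

End NonsmoothFunctions.

Section Graph.
Variables (R : realType) (N : nat).
Implicit Types a : 'M[R]_N.

Definition undirected a : Prop := forall i j, a i j = a j i.

Definition connected_graph a : Prop :=
  forall i j, connect (fun i j : 'I_N => 0 < a i j) i j.

Definition laplacian a : 'M[R]_N := diag_mx (\row_i \sum_j a i j) - a.

Definition smallest_positive_eigenvalue (L : 'M[R]_N) (lambda : R) : Prop :=
  [/\ eigenvalue L lambda, 0 < lambda &
      forall mu, eigenvalue L mu -> 0 < mu -> lambda <= mu].

End Graph.

Section AbsoluteContinuity.
Variables (R : realType) (V : normedModType R).
Implicit Types g : R -> V.

(* Finite families of non-overlapping subintervals [u k, v k] of [b, c]. *)
Definition abs_continuous_on (b c : R) g : Prop :=
  forall e : R, 0 < e -> exists2 delta : R, 0 < delta &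
    forall m (u v : 'I_m -> R),
      (forall k, [/\ b <= u k, u k <= v k & v k <= c]) ->
      (forall j k, j != k -> v j <= u k \/ v k <= u j) ->
      \sum_k (v k - u k) < delta ->
      \sum_k `|g (v k) - g (u k)| < e.

Definition locally_abs_continuous g : Prop :=
  forall T : R, 0 < T -> abs_continuous_on 0 T g.

End AbsoluteContinuity.

Section ResourceAllocation.
Variables (R : realType) (N n : nat).
Variables (f : 'I_N -> 'rV[R]_n -> R) (Omega : 'I_N -> set 'rV[R]_n).
Variable d : 'I_N -> 'rV[R]_n.

Definition slater : Prop :=
  exists z : 'I_N -> 'rV[R]_n,
    (forall i, relative_interior (Omega i) (z i)) /\
    \sum_i z i = \sum_i d i.

Definition feasible (y : 'I_N -> 'rV[R]_n) : Prop :=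
  \sum_i y i = \sum_i d i /\ forall i, Omega i (y i).

Definition optimal (y : 'I_N -> 'rV[R]_n) : Prop :=
  feasible y /\ forall z, feasible z -> \sum_i f i (y i) <= \sum_i f i (z i).

Definition output (x : 'I_N -> R -> 'rV[R]_n) (i : 'I_N) (t : R) : 'rV[R]_n :=
  proj (Omega i) (x i t).

Variables (a : 'M[R]_N) (k1 k2 k3 : R).

Definition diffuse (w : 'I_N -> 'rV[R]_n) (i : 'I_N) : 'rV[R]_n :=
  \sum_j a i j *: (w i - w j).

(* w_i^L - y_i + d_i *)
Definition mismatch (w y : 'I_N -> 'rV[R]_n) (i : 'I_N) : 'rV[R]_n :=
  diffuse w i - y i + d i.

(* The trajectories are functions on R of which only the restrictions to
   [0, +oo) matter: two-sided derivatives are required at positive times. *)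
Definition caratheodory_solution (x s w : 'I_N -> R -> 'rV[R]_n) : Prop :=
  [/\ forall i, locally_abs_continuous (x i),
      forall i, locally_abs_continuous (s i),
      forall i, locally_abs_continuous (w i) &
      {ae @lebesgue_measure R, forall t : R, 0 < t -> forall i,
        let y := output x ^~ t in
        let r := mismatch (w ^~ t) y in
        [/\ exists2 g, clarke_gradient (f i) (y i) g &
              is_derive t 1 (x i) (y i - x i t - g + s i t),
            is_derive t 1 (s i)
              (k1 *: r i + k2 *: \sum_j a i j *: (s j t - s i t)) &
            is_derive t 1 (w i) (k3 *: \sum_j a i j *: (r j - r i))]}].

End ResourceAllocation.

(* Main.v *)
Require Import Defs.
From mathcomp Require Import ring lra.

Set Implicit Arguments.
Unset Strict Implicit.
Unset Printing Implicit Defensive.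

(** Let [ys] be the optimal allocation and [lam] the multiplier of the resource
    constraint.  Stationarity says that [lam = g_i + nu_i] for a subgradient
    [g_i] of [f i] at [ys i] and a normal vector [nu_i] of [Omega i], and since
    [ys - d] sums to zero it is [L ws] for some [ws].  So the dynamics have an
    equilibrium, and along any solution, with [y_i] the projection of [x_i],

    [V = sum_i (|x_i - ys_i|^2 - |x_i - y_i|^2) / 2 + |s_i - lam|^2 / (2 k1)
               + (omega / k3) |w_i - ws_i|^2]

    decreases.  The difference of squares in [x_i] has gradient [y_i - ys_i],
    which pairs with the velocity of [x_i] to give [- omega |y - ys|^2] by strong
    convexity, plus a term [(y - ys) . (s - lam)] that the multiplier part
    cancels.  With [e = L (w - ws)], what remains is
    [(s - lam) . e - (k2 / k1) s . L s - 2 omega |e|^2 + 2 omega e . (y - ys)];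
    as [e] sums to zero only the deviation of [s] from its mean matters, on
    which [L] is at least [lambda2], and completing squares leaves
    [V' <= - (omega / 4) |y - ys|^2] ([lyapunov_decrease], [lyapunov_slope]).

    Hence [V] is nonincreasing, so [y] and [s] are bounded, so the Clarke
    gradients met along the way are bounded, so [x] is bounded
    ([bounded_drift]) and Lipschitz, and [y] is Lipschitz.  An excursion of [y]
    away from [ys] then costs a fixed amount of [V], and since [V >= 0] there
    are none after some time ([output_cvg]).

    Two ingredients have proofs of their own.  The multiplier comes from
    quadratic penalties ([lagrange_multiplier]); used with two blocks, the same
    lemma yields subgradients and the sum rule for a function and a
    constraint set ([subgradient_sum_rule]), and used with the [N] agents it
    yields [lam] ([kkt_exists]).  That an absolutely continuous function whose
    derivative is almost everywhere nonpositive does not increase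
    ([abs_continuous_nonincreasing]) is proved by Cousin's argument from the
    outer regularity of the Lebesgue measure. *)

(** * Euclidean geometry of row vectors *)

Section EuclideanSpace.
Variables (R : realType) (n : nat).
Implicit Types u v w p q : 'rV[R]_n.

Lemma dotC u v : dot u v = dot v u.
Proof. by apply: eq_bigr => k _; rewrite mulrC. Qed.

Lemma dotDl u v w : dot (u + v) w = dot u w + dot v w.
Proof. by rewrite -big_split; apply: eq_bigr => k _ /=; rewrite mxE mulrDl. Qed.

Lemma dotDr u v w : dot u (v + w) = dot u v + dot u w.
Proof. by rewrite dotC dotDl !(dotC u). Qed.

Lemma dotZl c u v : dot (c *: u) v = c * dot u v.
Proof. by rewrite mulr_sumr; apply: eq_bigr => k _; rewrite mxE mulrA. Qed.

Lemma dotZr c u v : dot u (c *: v) = c * dot u v.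
Proof. by rewrite dotC dotZl dotC. Qed.

Lemma dotNl u v : dot (- u) v = - dot u v.
Proof. by rewrite -scaleN1r dotZl mulN1r. Qed.

Lemma dotNr u v : dot u (- v) = - dot u v.
Proof. by rewrite dotC dotNl dotC. Qed.

Lemma dotBl u v w : dot (u - v) w = dot u w - dot v w.
Proof. by rewrite dotDl dotNl. Qed.

Lemma dotBr u v w : dot u (v - w) = dot u v - dot u w.
Proof. by rewrite dotDr dotNr. Qed.

Lemma dot0l u : dot 0 u = 0.
Proof. by rewrite -[0](scale0r 0) dotZl mul0r. Qed.

Lemma dot0r u : dot u 0 = 0.
Proof. by rewrite dotC dot0l. Qed.

Lemma dot_suml I (r : seq I) (P : pred I) (F : I -> 'rV[R]_n) u :
  dot (\sum_(i <- r | P i) F i) u = \sum_(i <- r | P i) dot (F i) u.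
Proof. by apply: (big_morph (fun v => dot v u)) => [v w|]; rewrite ?dotDl ?dot0l. Qed.

Lemma dot_sumr I (r : seq I) (P : pred I) (F : I -> 'rV[R]_n) u :
  dot u (\sum_(i <- r | P i) F i) = \sum_(i <- r | P i) dot u (F i).
Proof. by rewrite dotC dot_suml; apply: eq_bigr => i _; rewrite dotC. Qed.

Lemma dot_ge0 u : 0 <= dot u u.
Proof. by apply: sumr_ge0 => k _; rewrite -expr2 sqr_ge0. Qed.

Lemma dot_eq0 u : (dot u u == 0) = (u == 0).
Proof.
apply/eqP/eqP => [u0|->]; last by rewrite dot0l.
apply/rowP => k; rewrite mxE; apply/eqP; rewrite -sqrf_eq0 expr2.
by rewrite (psumr_eq0P _ u0)// => j _; rewrite -expr2 sqr_ge0.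
Qed.

Lemma dot_gt0 u : (0 < dot u u) = (u != 0).
Proof. by rewrite lt_def dot_ge0 andbT dot_eq0. Qed.

Lemma dotDD u v : dot (u + v) (u + v) = dot u u + 2 * dot u v + dot v v.
Proof. by rewrite !dotDl !dotDr (dotC v u); ring. Qed.

Lemma dotBB u v : dot (u - v) (u - v) = dot u u - 2 * dot u v + dot v v.
Proof. by rewrite dotDD dotNr dotNl dotNr; ring. Qed.

Lemma dot_young c u v : 0 < c -> 2 * dot u v <= c^-1 * dot u u + c * dot v v.
Proof.
move=> c0; have := dot_ge0 (u - c *: v).
rewrite dotBB !dotZr dotZl -(ler_pM2l (_ : 0 < c^-1)) ?invr_gt0// mulr0.
rewrite !mulrDr mulrN (_ : c^-1 * (2 * (c * _)) = 2 * dot u v); last first.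
  by rewrite mulrCA mulKf ?gt_eqF.
by rewrite mulKf ?gt_eqF//; lra.
Qed.

Lemma enorm_ge0 u : 0 <= enorm u.
Proof. exact: sqrtr_ge0. Qed.

Lemma enorm_sqr u : enorm u ^+ 2 = dot u u.
Proof. by rewrite sqr_sqrtr ?dot_ge0. Qed.

Lemma enorm_eq0 u : (enorm u == 0) = (u == 0).
Proof. by rewrite -sqrf_eq0 enorm_sqr dot_eq0. Qed.

Lemma enormZ c u : enorm (c *: u) = `|c| * enorm u.
Proof.
by rewrite /enorm dotZl dotZr mulrA -expr2 sqrtrM ?sqr_ge0// sqrtr_sqr.
Qed.

Lemma enormN u : enorm (- u) = enorm u.
Proof. by rewrite -scaleN1r enormZ normrN1 mul1r. Qed.

Lemma enormB u v : enorm (u - v) = enorm (v - u).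
Proof. by rewrite -enormN opprB. Qed.

Lemma enorm_le u c : 0 <= c -> (enorm u <= c) = (dot u u <= c ^+ 2).
Proof. by move=> c0; rewrite -enorm_sqr ler_sqr ?nnegrE ?enorm_ge0. Qed.

Lemma cauchy_schwarz u v : dot u v <= enorm u * enorm v.
Proof.
have [->|u0] := eqVneq u 0; first by rewrite dot0l mulr_ge0 ?enorm_ge0.
have [->|v0] := eqVneq v 0; first by rewrite dot0r mulr_ge0 ?enorm_ge0.
have eu : 0 < enorm u by rewrite lt_def enorm_eq0 u0 enorm_ge0.
have ev : 0 < enorm v by rewrite lt_def enorm_eq0 v0 enorm_ge0.
rewrite -(@ler_pM2l _ 2)//.
have := @dot_young (enorm u / enorm v) u v (divr_gt0 eu ev).
rewrite -!enorm_sqr => /le_trans; apply.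
rewrite le_eqVlt; apply/orP; left; apply/eqP; field.
by rewrite !gt_eqF.
Qed.

Lemma cauchy_schwarz_norm u v : `|dot u v| <= enorm u * enorm v.
Proof.
by rewrite ler_norml cauchy_schwarz lerNl -dotNl -(enormN u) cauchy_schwarz.
Qed.

Lemma ler_enormD u v : enorm (u + v) <= enorm u + enorm v.
Proof.
rewrite enorm_le ?addr_ge0 ?enorm_ge0// dotDD sqrrD !enorm_sqr.
by have := cauchy_schwarz u v; lra.
Qed.

Lemma ler_enormB u v : enorm (u - v) <= enorm u + enorm v.
Proof. by rewrite -(enormN v) ler_enormD. Qed.

Lemma coord_le_enorm u k : `|u 0 k| <= enorm u.
Proof.
rewrite -sqrtr_sqr ler_sqrt ?dot_ge0// /dot (bigD1 k)//= expr2 lerDl.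
by apply: sumr_ge0 => j _; rewrite -expr2 sqr_ge0.
Qed.

Lemma coord_le_norm u k : `|u 0 k| <= `|u|.
Proof.
rewrite [leRHS]/Num.norm /= mx_normrE.
by apply/bigmax_geP; right; exists (0, k).
Qed.

Lemma norm_le_enorm u : `|u| <= enorm u.
Proof.
rewrite [leLHS]/Num.norm /= mx_normrE; apply/bigmax_leP; split=> [|[i k] _ /=].
  exact: enorm_ge0.
by rewrite ord1 coord_le_enorm.
Qed.

Lemma enorm_le_norm u : enorm u <= n%:R * `|u|.
Proof.
have nM : 0 <= n%:R * `|u| by rewrite mulr_ge0.
rewrite enorm_le// (@le_trans _ _ (\sum_(k < n) `|u| ^+ 2))//.
  apply: ler_sum => k _; rewrite -expr2 -real_normK ?num_real//.
  by rewrite ler_sqr ?nnegrE// coord_le_norm.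
rewrite sumr_const card_ord exprMn -[leLHS]mulr_natl ler_wpM2r ?sqr_ge0//.
by rewrite -natrX ler_nat; case: (n) => // m; rewrite leq_pmulr.
Qed.

End EuclideanSpace.

(** * Convergence along ultrafilters *)

Section Convergence.
Variables (R : realType) (n : nat).
Implicit Types u v : 'rV[R]_n.

Lemma cvg_sum (V : normedModType R) (T : Type) (F : set_system T) {FF : Filter F}
    (I : Type) (r : seq I) (P : pred I) (g : I -> T -> V) (l : I -> V) :
  (forall i, P i -> g i x @[x --> F] --> l i) ->
  (\sum_(i <- r | P i) g i x) @[x --> F] --> \sum_(i <- r | P i) l i.
Proof.
apply: cvg_big.
exact: add_continuous.
Qed.

Lemma cvg_dot (T : Type) (F : set_system T) {FF : Filter F}
    (g h : T -> 'rV[R]_n) u v :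
  g x @[x --> F] --> u -> h x @[x --> F] --> v ->
  dot (g x) (h x) @[x --> F] --> dot u v.
Proof.
move=> gu hv; apply: cvg_sum => k _; apply: cvgM.
- exact: (cvg_comp _ _ gu (@coord_continuous _ _ _ 0 k u)).
- exact: (cvg_comp _ _ hv (@coord_continuous _ _ _ 0 k v)).
Qed.

Lemma cvg_le_cst (T : Type) (F : set_system T) {FF : ProperFilter F}
    (g : T -> R) (l c : R) :
  g x @[x --> F] --> l -> (\forall x \near F, g x <= c) -> l <= c.
Proof.
move=> gl gc; exact: (closed_cvg (fun r => r <= c) (@closed_le _ c) gc _ gl).
Qed.

Lemma cvg_ge_cst (T : Type) (F : set_system T) {FF : ProperFilter F}
    (g : T -> R) (l c : R) :
  g x @[x --> F] --> l -> (\forall x \near F, c <= g x) -> c <= l.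
Proof.
move=> gl gc; exact: (closed_cvg (fun r => c <= r) (@closed_ge _ c) gc _ gl).
Qed.

(** A single ultrafilter finer than the Frechet filter makes all bounded
    sequences of vectors converge at once; it replaces successive extractions
    of subsequences. *)
Lemma nat_ultrafilter :
  exists G : set_system nat, UltraFilter G /\ \oo `<=` G.
Proof. exact: ultraFilterLemma. Qed.

Lemma bounded_ultra_cvg (G : set_system nat) (FG : UltraFilter G)
    (u : nat -> 'rV[R]_n) (M : R) :
  (forall k, enorm (u k) <= M) -> exists p : 'rV[R]_n, u k @[k --> G] --> p.
Proof.
move=> uM; pose K := [set v : 'rV[R]_n | dot v v <= M ^+ 2].
have M0 : 0 <= M := le_trans (enorm_ge0 _) (uM 0%N).
have cK : compact K.
  apply: bounded_closed_compact.
    exists M; split; rewrite ?num_real// => c Mc v Kv /=.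
    by rewrite (le_trans (norm_le_enorm v))// (le_trans _ (ltW Mc))// enorm_le.
  have cd : continuous (fun v : 'rV[R]_n => dot v v).
    move=> v; have vv : (fun x : 'rV[R]_n => x) x @[x --> v] --> v by exact: cvg_id.
    exact: (cvg_dot vv vv).
  have := @closed_comp _ _ (fun v : 'rV[R]_n => dot v v)
            [set r | r <= M ^+ 2] (fun x _ => cd x) (@closed_le _ _).
  exact.
move: cK; rewrite compact_ultra => /(_ (fmap u G)) /=.
have FuG : UltraFilter (fmap u G).
  split; first exact: fmap_proper_filter.
  move=> H PH GH; rewrite predeqE => A; split=> [HA|]; last exact: GH.
  have [//|nA] := in_ultra_setVsetC (u @^-1` A) FG.
  have : H (A `&` ~` A) by apply: filterI => //; exact: GH.
  by rewrite setICr => /filter_ex[].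
case/(_ FuG).
  by apply: filterE => k; rewrite /K/= -enorm_le.
by move=> p [_ up]; exists p.
Qed.

End Convergence.

(** * Convexity and minimization *)

Section ConvexSegments.
Variables (R : realType) (V : lmodType R).

Lemma convex_setP (A : set V) : convex_set A <->
  forall p q t, A p -> A q -> 0 <= t <= 1 -> A (p + t *: (q - p)).
Proof.
split=> [cA p q t Ap Aq /andP[t0 t1]|cA p q l].
  have := cA q p (Itv01 t0 t1); rewrite !inE => /(_ Aq Ap).
  by rewrite /conv/= /unstable.onem scalerBl scale1r scalerBr addrCA.
rewrite !inE => Ap Aq; have := cA q p l%:num Aq Ap.
rewrite ge0 le1 => /(_ isT).
by rewrite /conv/= /unstable.onem scalerBl scale1r scalerBr addrCA.
Qed.

Lemma convex_functionP (A : set V) (f : V -> R) : convex_function A f <->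
  forall p q t, A p -> A q -> 0 <= t <= 1 ->
    f (p + t *: (q - p)) <= f p + t * (f q - f p).
Proof.
split=> [cf p q t Ap Aq /andP[t0 t1]|cf l p q].
  have := cf (Itv01 t0 t1) q p; rewrite !inE => /(_ Aq Ap).
  rewrite convRE [X in f X]/conv/= /unstable.onem scalerBl scale1r scalerBr.
  by rewrite addrCA => /le_trans; apply; lra.
rewrite !inE => Ap Aq; rewrite convRE [X in f X]/conv/= /unstable.onem.
rewrite scalerBl scale1r addrCA -scalerBr.
have := cf q p l%:num Aq Ap; rewrite ge0 le1 => /(_ isT) /le_trans; apply.
lra.
Qed.

End ConvexSegments.

Section Minimization.
Variables (R : realType) (n : nat).

(** Dividing by [t] and letting [t] tend to 0 turns minimality along a segment
    into a first-order condition; [t ^+ 2 * B] is the second-order term. *)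
Lemma slope_ge0 (A B : R) :
  (forall t, 0 < t <= 1 -> 0 <= t * A + t ^+ 2 * B) -> 0 <= A.
Proof.
move=> AB; rewrite leNgt; apply/negP => A0.
pose t := Num.min 1 (- A / (2 * (`|B| + 1))).
have B0 := normr_ge0 B.
have q0 : 0 < - A / (2 * (`|B| + 1)) by rewrite divr_gt0 ?oppr_gt0//; lra.
have t0 : 0 < t by rewrite lt_min ltr01.
have t1 : t <= 1 by rewrite ge_min lexx.
have := AB t; rewrite t0 t1 => /(_ isT).
rewrite expr2 -mulrA -mulrDr pmulr_rge0// => AtB.
have : t * (`|B| + 1) <= - A / 2.
  rewrite -ler_pdivlMr; last lra.
  by rewrite -mulrA -invfM ge_min lexx orbT.
have : t * B <= t * `|B| by rewrite ler_pM2l// ler_norm.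
nra.
Qed.

Variable G : set_system nat.
Hypothesis UG : UltraFilter G.
Hypothesis oG : \oo `<=` G.

Lemma ultra_cvg (V : topologicalType) (u : nat -> V) (l : V) :
  u k @[k --> \oo] --> l -> u k @[k --> G] --> l.
Proof. by move=> ul A /ul; apply: oG. Qed.

(** A minimizing sequence converges along the ultrafilter in all coordinates at
    once; hence continuity of [g] is stated along the ultrafilter rather than for
    a topology on the families. *)
Lemma product_minimizer (I : Type) (C : I -> set 'rV[R]_n) (M : R)
    (g : (I -> 'rV[R]_n) -> R) :
  (forall i, closed (C i)) -> (forall i p, C i p -> enorm p <= M) ->
  (forall (y : nat -> I -> 'rV[R]_n) l, (forall k i, C i (y k i)) ->
    (forall i, C i (l i)) ->
    (forall i, y k i @[k --> G] --> l i) -> g (y k) @[k --> G] --> g l) ->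
  (exists z, forall i, C i (z i)) ->
  exists y, (forall i, C i (y i)) /\
            forall y', (forall i, C i (y' i)) -> g y <= g y'.
Proof.
move=> Ccl CM gcont [z Cz].
have lim (y : nat -> I -> 'rV[R]_n) : (forall k i, C i (y k i)) ->
    exists2 l, forall i, C i (l i) & forall (c : R) (b : nat -> R),
      (forall k, g (y k) <= b k) ->
      (forall m, \forall k \near \oo, b k <= c + m.+1%:R^-1) -> g l <= c.
  move=> Cy.
  have /choice[l yl] : forall i, exists p : 'rV[R]_n, y k i @[k --> G] --> p.
    by move=> i; apply: (@bounded_ultra_cvg _ _ G UG _ M) => k; exact: (CM i).
  have Cl i : C i (l i).
    by apply: (closed_cvg _ (Ccl i) _ _ (yl i)); apply: filterE => k.
  exists l => // c b gb bc; apply/ler_addgt0Pr => e e0.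
  have [m _ me] := near_infty_natSinv_lt (PosNum e0).
  have glm := gcont _ _ Cy Cl yl.
  rewrite (@le_trans _ _ (c + m.+1%:R^-1))//; last first.
    by rewrite lerD2l ltW// (me m)/=.
  apply: (cvg_le_cst glm); apply: oG; move: (bc m); apply: filterS => k.
  exact: le_trans.
pose A := [set g y | y in [set y | forall i, C i (y i)]].
have A0 : A !=set0 by exists (g z), z.
have [Alb|Anb] := pselect (has_lbound A).
  have /choice[y yP] : forall k : nat, exists y, (forall i, C i (y i)) /\
      g y <= inf A + k.+1%:R^-1.
    move=> k; have k0 : 0 < k.+1%:R^-1 :> R by rewrite invr_gt0.
    have [_ [y Cy <-] /ltW yk] := inf_adherent k0 (conj A0 Alb).
    by exists y.
  have [l Cl gl] := lim y (fun k => (yP k).1).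
  exists l; split=> // y' Cy'; apply: le_trans (ge_inf Alb _); last first.
    by exists y'.
  apply: gl (fun k => (yP k).2) _ => m; exists m => // k /= mk.
  by rewrite lerD2l lef_pV2 ?posrE// ler_nat.
have /choice[y yP] : forall k : nat, exists y, (forall i, C i (y i)) /\
    g y <= - k%:R.
  move=> k; apply: contrapT => nk; apply: Anb; exists (- k%:R).
  move=> _ [y Cy <-]; rewrite leNgt; apply/negP => /ltW yk.
  by apply: nk; exists y.
have [l _ gl] := lim y (fun k => (yP k).1).
have : g l <= g l - 1; last by lra.
apply: gl (fun k => (yP k).2) _ => m.
have [k0 _ k0P] := nbhs_infty_ger (1 - g l).
exists k0 => // k /k0P /= kP; have m0 : 0 < m.+1%:R^-1 :> R by rewrite invr_gt0.
move: kP m0; set e := _^-1; set r := k%:R => *; lra.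
Qed.

End Minimization.

(** * A Lagrange multiplier from quadratic penalties *)

Section Multiplier.
Variables (R : realType) (n : nat) (I : finType).
Variables (C : I -> set 'rV[R]_n) (h : I -> 'rV[R]_n -> R).
Variables (z : I -> 'rV[R]_n) (M : R).
Hypothesis C_closed : forall i, closed (C i).
Hypothesis C_convex : forall i, convex_set (C i).
Hypothesis C_bounded : forall i p, C i p -> enorm p <= M.
Hypothesis h_convex : forall i, convex_function (C i) (h i).
Hypothesis h_cont : forall i p, C i p -> {for p, continuous (h i)}.
Hypothesis Cz : forall i, C i (z i).

Let S (y : I -> 'rV[R]_n) := \sum_i (y i - z i).
Let H (y : I -> 'rV[R]_n) := \sum_i h i (y i).

Let S_segment y y' t :
  S (fun i => y i + t *: (y' i - y i)) = S y + t *: (S y' - S y).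
Proof.
rewrite /S -sumrB scaler_sumr -big_split/=; apply: eq_bigr => i _.
by rewrite opprB addrA subrK addrAC.
Qed.

Section Penalty.
Variable G : set_system nat.
Hypothesis UG : UltraFilter G.
Hypothesis oG : \oo `<=` G.

Let S_cvg (y : nat -> I -> 'rV[R]_n) l :
  (forall i, y k i @[k --> G] --> l i) -> S (y k) @[k --> G] --> S l.
Proof. by move=> yl; apply: cvg_sum => i _; apply: cvgB => //; exact: cvg_cst. Qed.

Let H_cvg (y : nat -> I -> 'rV[R]_n) l : (forall i, C i (l i)) ->
  (forall i, y k i @[k --> G] --> l i) -> H (y k) @[k --> G] --> H l.
Proof.
move=> Cl yl; apply: cvg_sum => i _.
exact: (cvg_comp _ _ (yl i) (h_cont (Cl i))).
Qed.

(** This is the first-order condition for [H + (rho / 2) |S|^2]: it makes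
    [- rho *: S y] an approximate multiplier. *)
Let penalty_minimizer (rho : R) : exists y, (forall i, C i (y i)) /\
  forall y', (forall i, C i (y' i)) ->
    H y + rho * dot (S y) (S y) <= H y' + rho * dot (S y) (S y').
Proof.
have [|//|y [Cy ymin]] := @product_minimizer R n G UG oG I C M
    (fun y => H y + rho / 2 * dot (S y) (S y)) C_closed C_bounded.
- move=> y l Cy Cl yl; apply: cvgD; first exact: H_cvg.
  by apply: cvgM; [exact: cvg_cst|apply: cvg_dot; exact: S_cvg].
- by exists z.
exists y; split=> // y' Cy'.
suff : 0 <= H y' - H y + rho * (dot (S y) (S y') - dot (S y) (S y)) by lra.
apply: (@slope_ge0 _ _ (rho / 2 * dot (S y' - S y) (S y' - S y))).
move=> t /andP[t0 t1]; have t01 : 0 <= t <= 1 by rewrite ltW.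
pose yt i := y i + t *: (y' i - y i).
have Cyt i : C i (yt i) by apply: (convex_setP _).1.
have Hyt : H yt <= H y + t * (H y' - H y).
  rewrite /H -sumrB mulr_sumr -big_split/=; apply: ler_sum => i _.
  exact: (convex_functionP _ _).1.
have := ymin yt Cyt; rewrite /yt S_segment dotDD dotZr dotZl dotZr dotBr.
by rewrite -/yt; lra.
Qed.

(** If the penalty multipliers [lam k] were unbounded, their directions would
    accumulate at a unit vector [mu0] with [mu0 . S <= 0] on [C], hence
    [mu0 . S = 0] by qualification.  But each [lam k] is a multiple of
    [S (y k)], so [mu0] would be orthogonal to itself.  Once bounded, the
    multipliers and the minimizers converge along the ultrafilter. *)
Lemma penalty_multiplier :
  (forall mu : 'rV[R]_n,
    (forall y, (forall i, C i (y i)) -> dot mu (S y) <= 0) ->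
    forall y, (forall i, C i (y i)) -> dot mu (S y) = 0) ->
  exists y lam, [/\ forall i, C i (y i), S y = 0 &
    forall y', (forall i, C i (y' i)) -> H y + dot lam (S y') <= H y'].
Proof.
move=> cq.
have Sz : S z = 0 by rewrite /S big1// => i _; rewrite subrr.
have [m [_ Hm]] := penalty_minimizer 0; rewrite !mul0r addr0 in Hm.
have {}Hm y : (forall i, C i (y i)) -> H m <= H y.
  by move=> Cy; rewrite (le_trans (Hm _ Cy))// mul0r addr0.
have /choice[y /all_and2[Cy yP]] := fun k : nat => penalty_minimizer k.+1%:R.
pose lam k := - k.+1%:R *: S (y k).
have k1 k : 0 < k.+1%:R :> R by [].
(* the penalty term that is dropped here is nonnegative *)
have lamP k y' : (forall i, C i (y' i)) -> H (y k) + dot (lam k) (S y') <= H y'.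
  move=> Cy'; have := yP k _ Cy'; rewrite /lam dotZl.
  by have := mulr_ge0 (ltW (k1 k)) (dot_ge0 (S (y k))); lra.
have Sy k : dot (S (y k)) (S (y k)) <= (H z - H m) * k.+1%:R^-1.
  rewrite ler_pdivlMr// mulrC; have := yP k _ Cz; rewrite Sz dot0r mulr0 addr0.
  by have := Hm _ (Cy k); lra.
have [B lamB] : exists B, forall k, enorm (lam k) <= B.
  apply: contrapT => nB.
  have /choice[e eP] : forall j : nat, exists k, j.+1%:R < enorm (lam k).
    move=> j; apply: contrapT => nj; apply: nB; exists j.+1%:R => k.
    by rewrite leNgt; apply/negP => ?; apply: nj; exists k.
  have e0 j : 0 < enorm (lam (e j)) by apply: lt_trans (eP j).
  pose mu j := (enorm (lam (e j)))^-1 *: lam (e j).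
  have mu1 j : dot (mu j) (mu j) = 1.
    rewrite dotZl dotZr -enorm_sqr expr2 mulKf ?gt_eqF// mulVf ?gt_eqF//.
  have [mu0 muP] : exists p : 'rV[R]_n, mu j @[j --> G] --> p.
    apply: (@bounded_ultra_cvg _ _ G UG _ 1) => j.
    by rewrite enorm_le// mu1 expr1n.
  have mu0S y' : (forall i, C i (y' i)) -> dot mu0 (S y') = 0.
    apply: cq => {}y' Cy'.
    apply: (@ler_cvg_to _ G _ R (fun j => dot (mu j) (S y'))
             (fun j => (H y' - H m) * j.+1%:R^-1)).
    - exact: (cvg_dot muP (cvg_cst (S y'))).
    - rewrite -(mulr0 (H y' - H m)); apply: cvgM; first exact: cvg_cst.
      exact: (ultra_cvg oG (@cvg_harmonic R)).
    - apply: filterE => j; rewrite /mu dotZl mulrC.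
      have D0 : 0 <= H y' - H m by rewrite subr_ge0 Hm.
      rewrite (@le_trans _ _ ((H y' - H m) / enorm (lam (e j))))//.
        rewrite ler_pM2r ?invr_gt0//.
        by have := lamP (e j) _ Cy'; have := Hm _ (Cy (e j)); lra.
      by rewrite ler_wpM2l// lef_pV2 ?posrE// ltW.
  have mumu : dot (mu j) (mu j) @[j --> G] --> dot mu0 mu0 by exact: cvg_dot.
  have mumu' : dot (mu j) mu0 @[j --> G] --> dot mu0 mu0.
    exact: (cvg_dot muP (cvg_cst mu0)).
  have : 1 <= dot mu0 mu0.
    by apply: (cvg_ge_cst mumu); apply: filterE => j; rewrite mu1.
  have : dot mu0 mu0 <= 0.
    apply: (cvg_le_cst mumu'); apply: filterE => j.
    by rewrite dotC !dotZr mu0S// !mulr0.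
  lra.
have [l lP] : exists p : 'rV[R]_n, lam k @[k --> G] --> p.
  exact: (@bounded_ultra_cvg _ _ G UG _ B).
have /choice[x xP] : forall i, exists p : 'rV[R]_n, y k i @[k --> G] --> p.
  by move=> i; apply: (@bounded_ultra_cvg _ _ G UG _ M) => k; exact: (@C_bounded i).
have Cx i : C i (x i).
  by apply: (closed_cvg _ (@C_closed i) _ _ (xP i)); apply: filterE => k.
exists x, l; split=> //.
  apply/eqP; rewrite -dot_eq0 eq_le dot_ge0 andbT.
  apply: (@ler_cvg_to _ G _ R _ (fun k => (H z - H m) * k.+1%:R^-1) _ 0
           (cvg_dot (S_cvg xP) (S_cvg xP))) _ (nearW _ Sy).
  rewrite -[X in _ --> X](mulr0 (H z - H m)); apply: cvgM; first exact: cvg_cst.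
  exact: (ultra_cvg oG (@cvg_harmonic R)).
move=> y' Cy'.
apply: (@cvg_le_cst _ _ G _ (fun k => H (y k) + dot (lam k) (S y'))).
  by apply: cvgD; [exact: H_cvg | exact: (cvg_dot lP (cvg_cst (S y')))].
by apply: filterE => k; exact: lamP.
Qed.

End Penalty.

(** Qualification says that [0] lies in the relative interior of the image of
    the product of the [C i] under [y |-> \sum_i (y i - z i)]: a supporting
    hyperplane at [0] contains the whole image. *)
Hypothesis qualification : forall mu : 'rV[R]_n,
  (forall y, (forall i, C i (y i)) -> dot mu (\sum_i (y i - z i)) <= 0) ->
  forall y, (forall i, C i (y i)) -> dot mu (\sum_i (y i - z i)) = 0.

Lemma lagrange_multiplier : exists y lam,
  [/\ forall i, C i (y i), \sum_i (y i - z i) = 0 &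
   forall y', (forall i, C i (y' i)) ->
     \sum_i h i (y i) + dot lam (\sum_i (y' i - z i)) <= \sum_i h i (y' i)].
Proof.
by have [G [UG oG]] := nat_ultrafilter; exact: (penalty_multiplier UG oG).
Qed.

End Multiplier.

(** * Subgradients and Clarke gradients *)

Section Subgradients.
Variables (R : realType) (n : nat).
Implicit Types (p q g v : 'rV[R]_n) (A U : set 'rV[R]_n) (f : 'rV[R]_n -> R).

Definition subgradient U f p g := forall q, U q -> f p + dot g (q - p) <= f q.

Lemma small_step v (r : R) : 0 < r ->
  exists2 t : R, 0 < t <= 1 & t * enorm v <= r.
Proof.
move=> r0; have v0 := enorm_ge0 v; have d0 : 0 < enorm v + 1 by lra.
exists (Num.min 1 (r / (enorm v + 1))).
  by rewrite lt_min ltr01 divr_gt0//= ge_min lexx.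
rewrite (@le_trans _ _ (r / (enorm v + 1) * enorm v))//.
  by rewrite ler_wpM2r// ge_min lexx orbT.
by rewrite mulrAC ler_pdivrMr// ler_pM2l//; lra.
Qed.

Lemma nbhs_enormP A p : nbhs p A <->
  exists2 r : R, 0 < r & forall q, enorm (q - p) <= r -> A q.
Proof.
split=> [/nbhs_normP[e /= e0 eA]|[r r0 rA]].
  exists (e / 2); first by rewrite divr_gt0.
  move=> q qp; apply: eA; rewrite /ball_/= distrC.
  by rewrite (le_lt_trans (norm_le_enorm _))// (le_lt_trans qp)//; lra.
rewrite -nbhs_nbhs_norm; exists (r / n.+1%:R); first by rewrite /= divr_gt0.
move=> q; rewrite /ball_/= distrC ltr_pdivlMr// mulrC => /ltW qp; apply: rA.
rewrite (le_trans (enorm_le_norm _))// (le_trans _ qp)// ler_wpM2r//.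
by rewrite ler_nat.
Qed.

Lemma closed_dot_ball p (r : R) : closed [set q | dot (q - p) (q - p) <= r].
Proof.
have cd : continuous (fun q : 'rV[R]_n => dot (q - p) (q - p)).
  move=> q; have qp : (x - p) @[x --> q] --> q - p.
    exact: (cvgB (@cvg_id _ (nbhs q)) (cvg_cst p)).
  exact: (cvg_dot qp qp).
exact: (@closed_comp _ _ (fun q : 'rV[R]_n => dot (q - p) (q - p))
          [set s | s <= r] (fun x _ => cd x) (@closed_le _ _)).
Qed.

Lemma convex_dot_ball p (r : R) :
  convex_set [set q : 'rV[R]_n | dot (q - p) (q - p) <= r].
Proof.
apply/convex_setP => q q' t /= qr qr' /andP[t0 t1].
have -> : q + t *: (q' - q) - p = (1 - t) *: (q - p) + t *: (q' - p).
  apply/rowP => k; rewrite !mxE; ring.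
rewrite dotDD !dotZl !dotZr.
have := dot_ge0 ((q - p) - (q' - p)); rewrite dotBB => D0.
have t1' : 0 <= 1 - t by rewrite subr_ge0.
have := mulr_ge0 (mulr_ge0 t0 t1') D0.
have := ler_wpM2l t1' qr; have := ler_wpM2l t0 qr'.
lra.
Qed.

(** The difference quotients based at [p] itself are already at least
    [dot g v], and every set of the filter contains some of them. *)
Lemma subgradient_clarke U f p g :
  nbhs p U -> subgradient U f p g -> clarke_gradient f p g.
Proof.
move=> /nbhs_enormP[r r0 rU] fg v; apply: le_ereal_inf_tmp.
move=> _ [W [[A B] /= [Ap +]] + <-].
rewrite /at_right /within/= => /nbhs_ballP[e /= e0 eB] ABW.
have [t /andP[t0 _] tr] := small_step v r0.
pose s := Num.min t (e / 2).
have s0 : 0 < s by rewrite lt_min t0 divr_gt0.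
have se : s < e by rewrite gt_min; apply/orP; right; lra.
have Bs : B s.
  by apply: eB => //; rewrite /ball/= sub0r normrN gtr0_norm.
apply: le_trans (ereal_sup_ubound _); last first.
  exists (p, s) => //=; apply: ABW; split=> //=; exact: nbhs_singleton.
rewrite lee_fin /= ler_pdivlMr// mulrC -dotZr.
have := fg (p + s *: v); rewrite (addrC p) addrK; move=> fgs.
have /fgs : U (s *: v + p); last by rewrite addrC; lra.
apply: rU; rewrite addrK enormZ gtr0_norm// (le_trans _ tr)// ler_wpM2r//.
  exact: enorm_ge0.
by rewrite ge_min lexx.
Qed.

Lemma lipschitz_ball U f p : open U -> locally_lipschitz_on U f -> U p ->
  exists r L : R, [/\ 0 < r, 0 < L, forall q, enorm (q - p) <= r -> U q &
    forall q q', enorm (q - p) <= r -> enorm (q' - p) <= r ->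
      `|f q - f q'| <= L * enorm (q - q')].
Proof.
move=> Uo fL Up; have [V pV fV] := fL p Up.
have /nbhs_enormP[r r0 rUV] : nbhs p (U `&` V).
  by apply: filterI => //; exact: open_nbhs_nbhs.
have [L /= [L0 LUV]] := filter_ex (filterI (nbhs_pinfty_gt (num_real 0)) fV).
exists r, L; split=> // [q /rUV[]//|q q' /rUV UVq /rUV UVq'].
rewrite (le_trans (LUV (q, q') _))//= ler_pM2l//; exact: norm_le_enorm.
Qed.

Lemma locally_lipschitz_continuous U f p :
  open U -> locally_lipschitz_on U f -> U p -> {for p, continuous f}.
Proof.
move=> Uo fL Up; have [r [L [r0 L0 _ fr]]] := lipschitz_ball Uo fL Up.
rewrite /prop_for /continuous_at; apply/(@cvgrPdist_le _ _ _ (nbhs p)) => e e0.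
apply/nbhs_enormP; exists (Num.min r (e / L)).
  by rewrite lt_min r0 divr_gt0.
move=> q; rewrite le_min ler_pdivlMr// mulrC => /andP[qr qe].
by rewrite distrC (le_trans (fr _ _ _ _))// subrr enorm_le ?dot0l ?sqr_ge0 ?ltW.
Qed.

(** A Lipschitz constant [L] bounds the Clarke derivative in the direction [g]
    by [L * enorm g]; testing the gradient [g] against itself bounds [g]. *)
Lemma clarke_gradient_locally_bounded U f p :
  open U -> locally_lipschitz_on U f -> U p ->
  exists L, \forall q \near p, forall g, clarke_gradient f q g -> enorm g <= L.
Proof.
move=> Uo fL Up; have [r [L [r0 L0 _ fr]]] := lipschitz_ball Uo fL Up.
have r3 : 0 < r / 3 by rewrite divr_gt0.
exists L; apply/nbhs_enormP; exists (r / 3) => // q qp g /(_ g) gf.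
have [->|g0] := eqVneq g 0; first by rewrite enorm_le ?dot0l ?sqr_ge0 ?ltW.
have eg : 0 < enorm g by rewrite lt_def enorm_eq0 g0 enorm_ge0.
rewrite -(ler_pM2r eg) -expr2 enorm_sqr -lee_fin (le_trans gf)//.
pose A := [set q' : 'rV[R]_n | enorm (q' - q) <= r / 3].
pose B := [set s : R | 0 < s /\ s * enorm g <= r / 3].
apply: le_trans (ereal_inf_lbound _) _.
  exists (A `*` B) => //; exists (A, B) => //=; split.
    by apply/nbhs_enormP; exists (r / 3).
  rewrite /at_right /within/=; apply/nbhs_ballP.
  exists (r / 3 / enorm g); first by rewrite /= divr_gt0.
  move=> s /=; rewrite /ball/= sub0r normrN => sr s0; split=> //.
  by rewrite -ler_pdivlMr//; rewrite gtr0_norm// in sr; exact: ltW.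
apply: ge_ereal_sup => _ [[q' s] [/= Aq' [s0 sg]] <-].
have q'p : enorm (q' - p) <= r / 3 + r / 3.
  by rewrite -(subrKA q) (le_trans (ler_enormD _ _))// lerD.
rewrite lee_fin ler_pdivrMr// (le_trans (ler_norm _))//.
rewrite (le_trans (fr _ _ _ _))//.
- rewrite addrAC (le_trans (ler_enormD _ _))// enormZ gtr0_norm//; lra.
- lra.
- by rewrite addrAC subrr add0r enormZ gtr0_norm// -mulrA (mulrC s).
Qed.

End Subgradients.

Lemma dot_ball_bounded (R : realType) n (p q : 'rV[R]_n) (r : R) :
  dot (q - p) (q - p) <= r ^+ 2 -> 0 <= r -> enorm q <= enorm p + r.
Proof.
move=> qr r0; rewrite -enorm_le// in qr.
by rewrite -(subrK p q) addrC (le_trans (ler_enormD _ _))// lerD2l.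
Qed.

Section SumRule.
Variables (R : realType) (n : nat).
Variables (U : set 'rV[R]_n) (f : 'rV[R]_n -> R).
Hypothesis U_open : open U.
Hypothesis f_convex : convex_function U f.
Hypothesis f_lipschitz : locally_lipschitz_on U f.

Lemma convex_function_affine (A : set 'rV[R]_n) (l : 'rV[R]_n) :
  A `<=` U -> convex_function A (fun q => f q - dot l q).
Proof.
move=> AU; apply/convex_functionP => p q t Ap Aq t01.
have := (convex_functionP _ _).1 f_convex p q t (AU _ Ap) (AU _ Aq) t01.
by rewrite dotDr dotZr dotBr; lra.
Qed.

(** Convexity propagates the inequality along segments issued from [p]. *)
Lemma local_subgradient p g (r : R) : U p -> 0 < r ->
  (forall q, enorm (q - p) <= r -> f p + dot g (q - p) <= f q) ->
  subgradient U f p g.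
Proof.
move=> Up r0 fg q Uq.
have [t /andP[t0 t1] tr] := small_step (q - p) r0.
have t01 : 0 <= t <= 1 by rewrite ltW.
have := (convex_functionP _ _).1 f_convex p q t Up Uq t01.
have := fg (p + t *: (q - p)); rewrite (addrC p) addrK enormZ gtr0_norm//.
move=> /(_ tr); rewrite dotZr => fgt.
move=> /(le_trans fgt); rewrite lerD2l ler_pM2l//; lra.
Qed.

(** This is [lagrange_multiplier] for two blocks: [q1] in a small ball around
    [p] with cost [f - lam], and [- q2] with [q2] in [Omega] and cost 0, under
    the constraint [q1 - q2 = 0].  The multiplier splits the stationarity
    condition at [p] into a subgradient and a normal vector.  The constraint is
    qualified because [p] is interior to the ball. *)
Lemma subgradient_sum_rule (Omega : set 'rV[R]_n) p lam (r : R) :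
  closed Omega -> convex_set Omega -> Omega `<=` U -> Omega p -> 0 < r ->
  (forall q, Omega q -> enorm (q - p) <= r ->
    f p - dot lam p <= f q - dot lam q) ->
  exists2 g, subgradient U f p g &
    forall q, Omega q -> 0 <= dot (g - lam) (q - p).
Proof.
move=> Ocl Ocv OU Op r0 pmin; have Up := OU p Op.
have /nbhs_enormP[r1 r10 rU] : nbhs p U by exact: open_nbhs_nbhs.
pose r2 := Num.min r r1.
have r20 : 0 < r2 by rewrite lt_min r0.
pose B := [set q : 'rV[R]_n | dot (q - p) (q - p) <= r2 ^+ 2].
have BE q : B q <-> enorm (q - p) <= r2 by rewrite enorm_le// ltW.
have BU : B `<=` U.
  by move=> q /BE qr2; apply: rU; rewrite (le_trans qr2)// ge_min lexx orbT.
have Bcl : closed B by exact: closed_dot_ball.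
have Bcv : convex_set B by exact: convex_dot_ball.
have Bp : B p by rewrite /B/= subrr dot0l sqr_ge0.
pose C (b : bool) := if b then B else [set q | (Omega `&` B) (- q)].
pose h (b : bool) q := if b then f q - dot lam q else 0.
pose z (b : bool) := if b then p else - p.
pose y_ (q1 q2 : 'rV[R]_n) (b : bool) := if b then q1 else - q2.
have Cy q1 q2 : B q1 -> Omega q2 -> B q2 -> forall b, C b (y_ q1 q2 b).
  by move=> Bq1 Oq2 Bq2 [] //=; rewrite opprK.
have [|||||||y [g [Cyi Sy ymin]]] :=
  @lagrange_multiplier R n bool C h z (enorm p + r2).
- case=> //=.
  exact: (@closed_comp _ _ (fun q : 'rV[R]_n => - q) (Omega `&` B)
            (fun q _ => opp_continuous q) (closedI Ocl Bcl)).
- case=> //=; apply/convex_setP => q1 q2 t [Oq1 Bq1] [Oq2 Bq2] t01 /=.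
  have -> : - (q1 + t *: (q2 - q1)) = - q1 + t *: (- q2 - - q1).
    by apply/rowP => k; rewrite !mxE; ring.
  by split; apply: (convex_setP _).1.
- case=> q /=; first by move=> /dot_ball_bounded; apply; exact: ltW.
  by move=> [_ /dot_ball_bounded]; rewrite enormN; apply; exact: ltW.
- case=> /=; first exact: convex_function_affine.
  by apply/convex_functionP => *; rewrite subrr mulr0 addr0.
- case=> q Cq; last first.
    rewrite /prop_for /continuous_at /=. exact: (@cst_continuous _ _ (0:R) q).
  have qq : x @[x --> q] --> q by exact: cvg_id.
  apply: (@cvgB _ _ _ (nbhs q)).
    exact: locally_lipschitz_continuous U_open f_lipschitz (BU _ Cq).
  exact: (cvg_dot (cvg_cst lam) qq).
- by case=> //=; rewrite opprK.
- move=> mu muC.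
  have [t /andP[t0 _] tr] := small_step mu r20.
  have Bt : B (p + t *: mu).
    by apply/BE; rewrite (addrC p) addrK enormZ gtr0_norm.
  have := muC (y_ (p + t *: mu) p) (Cy _ _ Bt Op Bp).
  rewrite big_bool /= addrC subrr add0r addrAC subrr add0r dotZr pmulr_rle0//.
  rewrite le_eqVlt ltNge dot_ge0 orbF dot_eq0 => /eqP -> y' _.
  by rewrite dot0l.
move: Sy; rewrite big_bool /= opprK addrACA addNr addr0 => /eqP.
rewrite addr_eq0 => /eqP yE.
have [Oy By] : Omega (y true) /\ B (y true).
  by rewrite yE; exact: (Cyi false).
have Hp : f p - dot lam p <= f (y true) - dot lam (y true).
  by apply: pmin => //; rewrite (le_trans ((BE _).1 By))// ge_min lexx.
have {}ymin q1 q2 : B q1 -> Omega q2 -> B q2 ->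
    f p - dot lam p + dot g (q1 - q2) <= f q1 - dot lam q1.
  move=> Bq1 Oq2 Bq2; have := ymin _ (Cy _ _ Bq1 Oq2 Bq2).
  rewrite !big_bool /= !addr0 opprK addrACA addNr addr0; apply: le_trans.
  by rewrite lerD2r.
exists (g + lam).
  apply: (local_subgradient Up r20) => q /BE Bq.
  by have := ymin q p Bq Op Bp; rewrite dotDl !dotBr; lra.
move=> q Oq; rewrite addrK.
have [t /andP[t0 t1] tr] := small_step (q - p) r20.
have t01 : 0 <= t <= 1 by rewrite ltW.
have Oqt : Omega (p + t *: (q - p)) by apply: (convex_setP _).1.
have Bqt : B (p + t *: (q - p)).
  by apply/BE; rewrite (addrC p) addrK enormZ gtr0_norm.
have := ymin p _ Bp Oqt Bqt.
by rewrite opprD addNKr dotNr dotZr gerDl oppr_le0 pmulr_rge0.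
Qed.

(** Every point is the minimum of [f] on the singleton that it forms. *)
Lemma subgradient_exists p : U p -> exists g, subgradient U f p g.
Proof.
move=> Up.
have [|||||//|g gP _] := @subgradient_sum_rule [set p] p 0 1 => //.
- exact/accessible_closed_set1/hausdorff_accessible/norm_hausdorff.
- by apply/convex_setP => q q' t -> ->; rewrite subrr scaler0 addr0.
- by move=> q ->.
- by move=> q ->.
- by exists g.
Qed.

(** Strong monotonicity of the gradients is used between [p] and the midpoint of
    [p] and [q] only, which gives half of the best constant [omega / 2]. *)
Lemma strongly_convex_growth (Omega : set 'rV[R]_n) (omega : R) p q g :
  convex_set Omega -> Omega `<=` U -> strongly_convex_on Omega omega f ->
  Omega p -> Omega q -> subgradient U f p g ->
  f p + dot g (q - p) + omega / 4 * dot (q - p) (q - p) <= f q.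
Proof.
move=> Ocv OU fs Op Oq gp.
have [v vE v2] : exists2 v, v = (2^-1 : R) *: (q - p) & q - p = 2 *: v.
  by exists (2^-1 *: (q - p)); rewrite // scalerA divff// scale1r.
pose m := p + v.
have Om : Omega m by rewrite /m vE; apply: (convex_setP _).1 => //; lra.
have [gm gmP] := subgradient_exists (OU _ Om).
have UP x : Omega x -> nbhs x U by move=> Ox; apply: open_nbhs_nbhs; split=> //; exact: OU.
have := fs m p gm g Om Op (subgradient_clarke (UP _ Om) gmP)
  (subgradient_clarke (UP _ Op) gp).
have mp : m - p = v by rewrite /m addrC addKr.
have qm : q - m = v by rewrite /m opprD addrA v2 scaler_nat mulr2n addrK.
have := gmP q (OU _ Oq); have := gp m (OU _ Om).
rewrite qm mp enorm_sqr v2 !dotZr !dotZl (dotC v) dotBl.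
lra.
Qed.

End SumRule.

(** * Optimality conditions for the allocation problem *)

(** The prolongation of the segment from [y] to [z] beyond [z] stays in the
    affine hull. *)
Lemma relative_interior_extend (R : realType) n (A : set 'rV[R]_n) z y :
  relative_interior A z -> A y ->
  exists2 t : R, 0 < t <= 1 & A (z - t *: (y - z)).
Proof.
move=> [Az /nbhs_enormP[r r0 rA]] Ay.
have [t t01 tr] := small_step (y - z) r0; have /andP[t0 t1] := t01.
exists t => //; apply: rA.
  by rewrite addrC addKr enormN enormZ gtr0_norm.
(* [z - t (y - z)] is the affine combination [(1 + t) z - t y] *)
exists 2%N, (fun k : 'I_2 => if k == 0 then z else y).
exists (fun k : 'I_2 => if k == 0 then 1 + t else - t); split.
- by move=> k; case: ifP.
- by rewrite !big_ord_recl big_ord0/=; ring.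
- by rewrite !big_ord_recl big_ord0/=; apply/rowP => k; rewrite !mxE; ring.
Qed.

Section SingleUpdate.
Variables (I : finType) (T : Type) (V : zmodType).

Definition update (y : I -> T) i q j := if j == i then q else y j.

Lemma sum_update (F : I -> T -> V) y i q :
  \sum_j F j (update y i q j) = \sum_j F j (y j) + (F i q - F i (y i)).
Proof.
rewrite (bigD1 i)//= [in RHS](bigD1 i)//= /update eqxx.
rewrite [RHS]addrC addrA subrK; congr (_ + _).
by apply: eq_bigr => j /negbTE ->.
Qed.

End SingleUpdate.

Section Optimality.
Variables (R : realType) (N n : nat) (U Omega : 'I_N -> set 'rV[R]_n).
Variables (f : 'I_N -> 'rV[R]_n -> R) (d : 'I_N -> 'rV[R]_n) (omega : R).
Hypothesis Omega_closed : forall i, closed (Omega i).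
Hypothesis Omega_convex : forall i, convex_set (Omega i).
Hypothesis U_open : forall i, open (U i).
Hypothesis OmegaU : forall i, Omega i `<=` U i.
Hypothesis f_convex : forall i, convex_function (U i) (f i).
Hypothesis f_lipschitz : forall i, locally_lipschitz_on (U i) (f i).
Hypothesis hslater : slater Omega d.
Hypothesis omega_gt0 : 0 < omega.
Hypothesis f_strong : forall i, strongly_convex_on (Omega i) omega (f i).

Lemma growth i p q g : Omega i p -> Omega i q -> subgradient (U i) (f i) p g ->
  f i p + dot g (q - p) + omega / 4 * dot (q - p) (q - p) <= f i q.
Proof.
move=> Op Oq gp.
exact: (strongly_convex_growth (@U_open i) (@f_convex i)
  (@f_lipschitz i) (@Omega_convex i) (@OmegaU i) (@f_strong i) Op Oq gp).
Qed.

(** The sets [Omega i] are cut by balls around the Slater point [z] to make them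
    compact.  By quadratic growth at [z], a feasible point no worse than [z]
    is at distance at least 1 from the spheres, so the cut is not felt by
    the minimizer.  Qualification holds since [z i] is a relative interior
    point: each [q] in [Omega i] has an opposite point on the other side of
    [z i]. *)
Lemma kkt_exists : exists y lam g, [/\ feasible Omega d y,
  forall i, subgradient (U i) (f i) (y i) (g i) &
  forall i q, Omega i q -> 0 <= dot (g i - lam) (q - y i)].
Proof.
have [z [zri zd]] := hslater.
have Oz i : Omega i (z i) by have [] := zri i.
have /choice[gz gzP] i := subgradient_exists (@U_open i)
  (@f_convex i) (@f_lipschitz i) (OmegaU (Oz i)).
pose K := \sum_i 2 / omega * dot (gz i) (gz i).
have K0 : 0 <= K by apply: sumr_ge0 => i _; rewrite mulr_ge0 ?dot_ge0// divr_ge0// ltW.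
pose b := Num.sqrt (8 / omega * K) + 1.
have b0 : 0 <= b by rewrite addr_ge0 ?sqrtr_ge0.
pose C i := Omega i `&` [set q | dot (q - z i) (q - z i) <= b ^+ 2].
have zC i : C i (z i) by split=> //=; rewrite subrr dot0l sqr_ge0.
have CE i q : C i q <-> Omega i q /\ enorm (q - z i) <= b by rewrite enorm_le.
have zpush i q : C i q ->
    exists2 t, 0 < t <= 1 & C i (z i - t *: (q - z i)).
  move=> /CE[Oq qb]; have [t t01 Ot] := relative_interior_extend (zri i) Oq.
  have /andP[t0 t1] := t01.
  exists t => //; apply/CE; split=> //.
  rewrite addrC addKr enormN enormZ gtr0_norm// (le_trans _ qb)//.
  exact: ler_piMl (enorm_ge0 _) t1.
pose M := \sum_i enorm (z i) + b.
have [|||||||y [lam [Cy Sy ymin]]] :=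
  @lagrange_multiplier R n 'I_N C f z M.
- by move=> i; apply: closedI; [exact: Omega_closed | exact: closed_dot_ball].
- move=> i; apply/convex_setP => p q t [Op bp] [Oq bq] t01; split.
    exact: (convex_setP _).1.
  by apply: ((convex_setP _).1 (@convex_dot_ball _ _ (z i) (b ^+ 2))).
- move=> i q [_ /dot_ball_bounded/(_ b0)] /le_trans; apply.
  rewrite lerD2r (bigD1 i)//= lerDl sumr_ge0// => j _; exact: enorm_ge0.
- move=> i; apply/convex_functionP => p q t [Op _] [Oq _].
  by apply: (convex_functionP _ _).1; [exact: f_convex | exact: OmegaU..].
- move=> i p [Op _].
  by apply: (@locally_lipschitz_continuous _ _ (U i)); [| |exact: OmegaU].
- exact: zC.
- move=> mu muC.
  have mu1 i q : C i q -> dot mu (q - z i) <= 0.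
    move=> Cq; have := muC (update z i q).
    rewrite (sum_update (fun j p => p - z j)) subrr subr0.
    rewrite big1 ?add0r => [|j _]; last by rewrite subrr.
    by apply=> j; rewrite /update; case: eqP => [->|].
  move=> y Cy; rewrite dot_sumr big1// => i _; apply/eqP.
  rewrite eq_le mu1//=; have [t /andP[t0 _] Ct] := zpush i _ (Cy i).
  by have := mu1 _ _ Ct; rewrite addrC addKr dotNr dotZr oppr_le0 pmulr_rge0.
have yz i : enorm (y i - z i) <= b - 1.
  rewrite addrK enorm_le ?sqrtr_ge0// sqr_sqrtr; last first.
    by rewrite mulr_ge0// divr_ge0// ltW.
  suff : \sum_j omega / 8 * dot (y j - z j) (y j - z j) <= K.
    rewrite mulrAC ler_pdivlMr// => /(le_trans _) h.
    suff : omega / 8 * dot (y i - z i) (y i - z i) <= K by lra.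
    apply: h; rewrite (bigD1 i)//= lerDl sumr_ge0// => j _.
    by rewrite mulr_ge0 ?dot_ge0// divr_ge0// ltW.
  have := ymin z zC; rewrite [X in dot _ X]big1 => [|i0 _]; last by rewrite subrr.
  rewrite dot0r addr0 -subr_ge0 -sumrB => fyz.
  rewrite -subr_ge0 -sumrB (le_trans fyz)//; apply: ler_sum => j _.
  have := growth (Oz j) (Cy j).1 (gzP j).
  have c0 : 0 < omega / 4 by rewrite divr_gt0.
  have := dot_young (- gz j) (y j - z j) c0.
  rewrite dotNl dotNl dotNr opprK invf_div.
  by lra.
have ymin1 i q : Omega i q -> enorm (q - y i) <= 1 ->
    f i (y i) - dot lam (y i) <= f i q - dot lam q.
  move=> Oq q1; have Cq : C i q.
    apply/CE; split=> //; rewrite -(subrKA (y i)) (le_trans (ler_enormD _ _))//.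
    by have := yz i; lra.
  have := ymin (update y i q); rewrite (sum_update f).
  rewrite (sum_update (fun j p => p - z j)) Sy add0r.
  rewrite opprB addrA subrK lerD2l dotBr => h.
  suff : dot lam q - dot lam (y i) <= f i q - f i (y i) by lra.
  by apply: h => j; rewrite /update; case: eqP => [->|].
have /choice[g gP] : forall i, exists g, subgradient (U i) (f i) (y i) g /\
    forall q, Omega i q -> 0 <= dot (g - lam) (q - y i).
  move=> i; have [g ? ?] := subgradient_sum_rule (@U_open i) (@f_convex i)
    (@f_lipschitz i) (@Omega_closed i) (@Omega_convex i) (@OmegaU i) (Cy i).1
    ltr01 (@ymin1 i).
  by exists g.
exists y, lam, g; split.
- split=> [|i]; last exact: (Cy i).1.
  by apply/eqP; rewrite -zd -subr_eq0 -sumrB Sy.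
- by move=> i; exact: (gP i).1.
- by move=> i; exact: (gP i).2.
Qed.

(** Growth at [y] is summed over the agents; the multiplier sees only the total
    of an allocation, which is the same for all feasible points. *)
Lemma kkt_optimal y lam g : feasible Omega d y ->
  (forall i, subgradient (U i) (f i) (y i) (g i)) ->
  (forall i q, Omega i q -> 0 <= dot (g i - lam) (q - y i)) ->
  optimal f Omega d y /\ forall z, optimal f Omega d z -> z = y.
Proof.
move=> [yd Oy] gy gn.
have key z : feasible Omega d z ->
    \sum_i f i (y i) + \sum_i omega / 4 * dot (z i - y i) (z i - y i) <=
    \sum_i f i (z i).
  move=> [zd Oz].
  have zy : \sum_i dot lam (z i - y i) = 0.
    by rewrite -dot_sumr sumrB zd yd subrr dot0r.
  suff : \sum_i (f i (y i) + omega / 4 * dot (z i - y i) (z i - y i) +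
      dot lam (z i - y i)) <= \sum_i f i (z i).
    by rewrite !big_split/= zy addr0.
  apply: ler_sum => i _.
  have := growth (Oy i) (Oz i) (gy i); have := gn i _ (Oz i).
  rewrite dotBl; lra.
have w0 : 0 <= omega / 4 by rewrite divr_ge0// ltW.
have q0 (z : 'I_N -> 'rV[R]_n) i : true -> 0 <= omega / 4 * dot (z i - y i) (z i - y i).
  by move=> _; rewrite mulr_ge0// dot_ge0.
split.
  split=> // z /key; apply: le_trans; rewrite lerDl.
  by apply: sumr_ge0 => i; exact: q0.
move=> z [zf /(_ y (conj yd Oy)) zy].
have : \sum_i omega / 4 * dot (z i - y i) (z i - y i) <= 0.
  by have := key _ zf; lra.
move=> s0; have {}s0 : \sum_i omega / 4 * dot (z i - y i) (z i - y i) = 0.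
  by apply/eqP; rewrite eq_le s0 sumr_ge0// => i; exact: q0.
apply/funext => i; have /(_ i isT) := psumr_eq0P (q0 z) s0.
by move/eqP; rewrite mulf_eq0 gt_eqF ?divr_gt0//= dot_eq0 subr_eq0 => /eqP.
Qed.

End Optimality.

(** * Absolutely continuous functions with nonpositive derivative *)

Section AbsoluteContinuityCalculus.
Variables (R : realType) (b c : R).

Lemma abs_continuous_dominated (V W : normedModType R) (h : R -> V)
    (g : R -> W) (K L : R) : 0 <= K -> 0 <= L ->
  abs_continuous_on b c h ->
  (forall u v, b <= u -> u <= v -> v <= c ->
    `|g v - g u| <= K * `|h v - h u| + L * (v - u)) ->
  abs_continuous_on b c g.
Proof.
move=> K0 L0 hac gh e e0.
have K1 : 0 < 2 * (K + 1) by lra.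
have L1 : 0 < 2 * (L + 1) by lra.
have [dl dl0 hd] := hac (e / (2 * (K + 1))) (divr_gt0 e0 K1).
exists (Num.min dl (e / (2 * (L + 1)))); first by rewrite lt_min dl0 divr_gt0.
move=> m u v uv uv_disj; rewrite lt_min => /andP[ud ue].
have {}hd := hd m u v uv uv_disj ud.
have S0 : 0 <= \sum_k (v k - u k).
  by apply: sumr_ge0 => k _; rewrite subr_ge0; have [] := uv k.
have H0 : 0 <= \sum_k `|h (v k) - h (u k)| by exact: sumr_ge0.
apply: (@le_lt_trans _ _ (K * (\sum_k `|h (v k) - h (u k)|) +
                          L * \sum_k (v k - u k))).
  rewrite !mulr_sumr -big_split/=; apply: ler_sum => k _.
  by have [? ? ?] := uv k; exact: gh.
rewrite ltr_pdivlMr// in hd; rewrite ltr_pdivlMr// in ue.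
nra.
Qed.

Lemma abs_continuousD (g h : R -> R) : abs_continuous_on b c g ->
  abs_continuous_on b c h -> abs_continuous_on b c (fun t => g t + h t).
Proof.
move=> gac hac e e0; have e2 : 0 < e / 2 by rewrite divr_gt0.
have [d1 d10 gd] := gac _ e2; have [d2 d20 hd] := hac _ e2.
exists (Num.min d1 d2); first by rewrite lt_min d10.
move=> m u v uv uv_disj; rewrite lt_min => /andP[ud1 ud2].
have {}gd := gd m u v uv uv_disj ud1; have {}hd := hd m u v uv uv_disj ud2.
rewrite [ltRHS]splitr; apply: le_lt_trans (ltrD gd hd).
rewrite -big_split/=; apply: ler_sum => k _.
by rewrite opprD addrACA ler_normD.
Qed.

End AbsoluteContinuityCalculus.

Section Monotonicity.
Variable R : realType.
Implicit Types (g : R -> R) (t l : R).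

(** Differentiability of [g] at [t] with derivative [l], with radii instead of
    filters since Cousin's argument works with gauges. *)
Definition has_slope g t l := forall e : R, 0 < e ->
  exists2 r : R, 0 < r & forall u, `|u - t| < r ->
    `|g u - g t - l * (u - t)| <= e * `|u - t|.

Notation mu := (@lebesgue_measure R).

Section Cousin.
Variables (g : R -> R) (b c e : R) (D U : set R).
Hypothesis bc : b <= c.
Hypothesis e_gt0 : 0 < e.
Hypothesis U_open : open U.
Hypothesis DU : D `<=` U.
Hypothesis g_slope : forall t, b <= t -> t <= c -> ~ D t ->
  exists2 l, l <= 0 & has_slope g t l.

(** Of a fine tagged partition of [[b, t]] only the intervals tagged in the
    exceptional set [D] are recorded, as [[u k, v k]]; they are contained in
    [U], whence the bound on their total length.  The other ones contribute at
    most [e] times their length to the increment. *)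
Let covered t := exists m (u v : nat -> R),
  [/\ forall k, (k < m)%N -> [/\ b <= u k, u k <= v k & v k <= t],
      forall j k, (j < k < m)%N -> v j <= u k,
      ((\sum_(k < m) (v k - u k))%:E <= mu (U `&` `]b, t]))%E &
      g t - g b <= e * (t - b) + \sum_(k < m) `|g (v k) - g (u k)|].

Let mU (t t' : R) : measurable (U `&` `]t, t']).
Proof. by apply: measurableI => //; exact: measurable_realfun.open_measurable. Qed.

Let covered_slope t t' : t <= t' -> g t' - g t <= e * (t' - t) ->
  covered t -> covered t'.
Proof.
move=> tt' gtt' [m [u [v [uvt uv_disj uvU guv]]]].
exists m, u, v; split=> //.
- by move=> k /uvt[bu uv vt]; split=> //; exact: le_trans tt'.
- apply: le_trans uvU _; apply: le_measure; [by rewrite inE; exact: mU..|].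
  apply: setIS => x /=; rewrite !in_itv/= => /andP[-> xt].
  exact: le_trans tt'.
- lra.
Qed.

Let covered_exceptional t t' : b <= t -> t <= t' ->
  (forall u, t <= u <= t' -> U u) -> covered t -> covered t'.
Proof.
move=> bt tt' tU [m [u [v [uvt uv_disj uvU guv]]]].
exists m.+1, (fun k => if k == m then t else u k),
  (fun k => if k == m then t' else v k); split.
- move=> k; rewrite ltnS leq_eqVlt; case: eqP => [_ _|_ /=]; first by split.
  by move=> /uvt[bu uv vt]; split=> //; exact: le_trans tt'.
- move=> j k /andP[jk]; rewrite ltnS leq_eqVlt.
  case: eqP => [km _|_ /= km].
    by rewrite km in jk; rewrite ltn_eqF//; have [] := uvt j jk.
  by rewrite ltn_eqF ?(ltn_trans jk)// uv_disj// jk.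
- rewrite big_ord_recr/= eqxx.
  under eq_bigr => k _ do rewrite ltn_eqF//.
  have -> : U `&` `]b, t'] = (U `&` `]b, t]) `|` `]t, t'].
    apply/seteqP; split=> x /=; rewrite !in_itv/=.
      move=> [Ux /andP[bx xt']]; have [xt|tx] := leP x t; first by left; rewrite bx.
      by right; rewrite xt'.
    move=> [[Ux /andP[bx xt]]|/andP[tx xt']].
      by split=> //; rewrite bx (le_trans xt).
    by split; [apply: tU; rewrite ltW|rewrite (le_lt_trans bt)].
  rewrite measureU//=; [|exact: mU|]; last first.
    apply/seteqP; split=> x //=; rewrite !in_itv/=.
    by move=> [[_ /andP[_ xt]] /andP[/lt_le_trans/(_ xt)]]; rewrite ltxx.
  rewrite EFinD leeD//.
  rewrite lebesgue_measure_itv/= lte_fin.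
  move: tt'; rewrite le_eqVlt => /predU1P[->|->]; last by rewrite -EFinB.
  by rewrite subrr ltxx.
- rewrite big_ord_recr/= eqxx.
  under eq_bigr => k _ do rewrite ltn_eqF//.
  have := ler_norm (g t' - g t).
  have : 0 <= e * (t' - t) by rewrite mulr_ge0 ?subr_ge0// ltW.
  lra.
Qed.

Let gauge t : b <= t -> t <= c -> exists2 r, 0 < r &
  forall u v, b <= u -> t - r < u -> u <= t -> t <= v -> v < t + r ->
    covered u -> covered v.
Proof.
move=> bt tc; have [Dt|nDt] := pselect (D t).
  have /nbhs_ballP[r /= r0 rU] : nbhs t U.
    by apply: open_nbhs_nbhs; split=> //; exact: DU.
  exists r => // u v bu tu ut tv vt; apply: covered_exceptional => //.
    exact: le_trans tv.
  move=> x /andP[ux xv]; apply: rU; rewrite /ball/= ltr_norml; lra.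
have [l l0 /(_ e e_gt0)[r r0 gr]] := g_slope bt tc nDt.
exists r => // u v bu tu ut tv vt; apply: covered_slope; first lra.
have ut0 : u - t <= 0 by lra.
have tv0 : 0 <= v - t by lra.
have /gr : `|u - t| < r by rewrite ltr_norml; lra.
have /gr : `|v - t| < r by rewrite ltr_norml; lra.
rewrite (ger0_norm tv0) (ler0_norm ut0) !ler_norml => /andP[_ h1] /andP[h2 _].
have := mulr_le0_ge0 l0 tv0; have := mulr_le0 l0 ut0.
lra.
Qed.

(** The gauge at the supremum of the points reached by fine partitions lets one
    go past it, unless it is [c]. *)
Let covered_end : covered c.
Proof.
pose S := [set t | [/\ b <= t, t <= c & covered t]].
have Sb : S b.
  split=> //; exists 0%N, (fun=> 0), (fun=> 0); split=> //.
    by rewrite big_ord0 measure_ge0.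
  by rewrite big_ord0 !subrr mulr0 addr0.
have Sub : ubound S c by move=> t [].
have Ssup : has_sup S by split; [exists b | exists c].
have bs : b <= sup S by apply: ub_le_sup => //; exists c.
have sc : sup S <= c by apply: ge_sup => //; exists b.
have [r r0 rP] := gauge bs sc.
have [t [bt tc ct] rt] := sup_adherent r0 Ssup.
have ts : t <= sup S by apply: ub_le_sup => //; exists c.
(* a point within the gauge beyond the supremum *)
pose t' := Num.min c (sup S + r / 2).
have st' : sup S <= t' by rewrite le_min sc/=; lra.
have t'r : t' < sup S + r by rewrite gt_min; apply/orP; right; lra.
have ct' : covered t' := rP _ _ bt rt ts st' t'r ct.
have t's : t' <= sup S.
  apply: ub_le_sup; first by exists c.
  by split=> //; [exact: le_trans st' | rewrite ge_min lexx].
move: ct' t's; rewrite /t'.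
have [//|cs _] := leP c (sup S + r / 2).
by move=> h; exfalso; move: h; apply/negP; rewrite -ltNge; lra.
Qed.

Lemma cousin_bound : exists m (u v : nat -> R),
  [/\ forall k, (k < m)%N -> [/\ b <= u k, u k <= v k & v k <= c],
      forall j k, (j < k < m)%N -> v j <= u k,
      ((\sum_(k < m) (v k - u k))%:E <= mu U)%E &
      g c - g b <= e * (c - b) + \sum_(k < m) `|g (v k) - g (u k)|].
Proof.
have [m [u [v [uvt uv_disj uvU guv]]]] := covered_end.
exists m, u, v; split=> //; apply: le_trans uvU _.
apply: le_measure; [by rewrite inE; exact: mU| |exact: subIsetl].
by rewrite inE; exact: measurable_realfun.open_measurable.
Qed.

End Cousin.

(** The exceptional null set lies in an open set whose measure is below the
    [delta] of absolute continuity for [e], so the partition intervals in it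
    carry a variation of at most [e]. *)
Lemma abs_continuous_nonincreasing g (b c : R) (A : set R) : b <= c ->
  abs_continuous_on b c g -> mu.-negligible A ->
  (forall t, b < t -> t < c -> ~ A t -> exists2 l, l <= 0 & has_slope g t l) ->
  g c <= g b.
Proof.
move=> bc gac [A' [mA' A'0 AA']] gs.
suff key e : 0 < e -> g c - g b <= e * (c - b) + e.
  rewrite -subr_le0; apply/ler_addgt0Pr => e e0; rewrite add0r.
  have cb : 0 < c - b + 1 by rewrite ltr_wpDl// subr_ge0.
  rewrite (le_trans (key _ (divr_gt0 e0 cb)))//.
  rewrite le_eqVlt; apply/orP; left; apply/eqP; field.
  by rewrite gt_eqF.
move=> e0; have [dl dl0 gd] := gac e e0.
pose D := A' `|` [set b] `|` [set c].
have mD : measurable D by do 2!apply: measurableU => //.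
have D0 : mu D = 0%E.
  by rewrite !measureU0//; try exact: lebesgue_measure_set1; exact: measurableU.
have Doo : (mu D < +oo)%E by rewrite D0.
have [U [Uo DU UD]] := lebesgue_regularity_outer mD Doo dl0.
have Udl : (mu U < dl%:E)%E.
  have -> : U = (U `\` D) `|` D by rewrite setUC setDUK.
  have mU := measurable_realfun.open_measurable Uo.
  by rewrite measureU0//; exact: measurableD.
have [m [u [v [uvt uv_disj uvU guv]]]] : exists m (u v : nat -> R),
  [/\ forall k, (k < m)%N -> [/\ b <= u k, u k <= v k & v k <= c],
      forall j k, (j < k < m)%N -> v j <= u k,
      ((\sum_(k < m) (v k - u k))%:E <= mu U)%E &
      g c - g b <= e * (c - b) + \sum_(k < m) `|g (v k) - g (u k)|].
  apply: (cousin_bound bc e0 Uo DU) => t bt tc nDt; apply: gs.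
  - by rewrite lt_neqAle bt andbT; apply/eqP => bt'; apply: nDt; left; right.
  - by rewrite lt_neqAle tc andbT; apply/eqP => bt'; apply: nDt; right.
  - by move=> At; apply: nDt; left; left; exact: AA'.
rewrite (le_trans guv)// lerD2l ltW//.
apply: (gd m (fun k => u k) (fun k => v k)).
- by move=> k; apply: uvt.
- move=> j k; rewrite neq_ltn => /orP[jk|kj]; [left|right].
    by apply: uv_disj; rewrite jk ltn_ord.
  by apply: uv_disj; rewrite kj ltn_ord.
- by rewrite -lte_fin (le_lt_trans uvU).
Qed.

End Monotonicity.

(** * Projections and squared distances *)

Section Projection.
Variables (R : realType) (n : nat) (A : set 'rV[R]_n).
Hypothesis A_closed : closed A.
Hypothesis A_convex : convex_set A.
Hypothesis A_nonempty : A !=set0.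
Implicit Types p q : 'rV[R]_n.

Lemma proj_spec p : A (proj A p) /\
  forall q, A q -> enorm (p - proj A p) <= enorm (p - q).
Proof.
suff : exists q, [set q | A q /\ forall r, A r -> enorm (p - q) <= enorm (p - r)] q.
  by move=> [q qP]; rewrite /proj; case: xgetP => [_ -> []//|/(_ q)].
have [a Aa] := A_nonempty; have [G [UG oG]] := nat_ultrafilter.
pose b := enorm (a - p); have b0 : 0 <= b by exact: enorm_ge0.
pose C (_ : unit) := A `&` [set q | dot (q - p) (q - p) <= b ^+ 2].
have [||||y [Cy ymin]] := @product_minimizer R n G UG oG unit C (enorm p + b)
    (fun y => dot (y tt - p) (y tt - p)).
- by move=> i; apply: closedI => //; exact: closed_dot_ball.
- by move=> i q [_ /dot_ball_bounded/(_ b0)].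
- move=> y l _ _ /(_ tt) yl.
  by apply: cvg_dot; apply: cvgB => //; exact: cvg_cst.
- by exists (fun=> a) => i; split=> //=; rewrite -enorm_le.
exists (y tt); split=> [|r Ar]; first by have [] := Cy tt.
rewrite enormB [leRHS]enormB.
have [rb|/ltW br] := leP (enorm (r - p)) b.
  rewrite enorm_le ?enorm_ge0// enorm_sqr; apply: (ymin (fun=> r)) => i.
  by split=> //=; rewrite -enorm_le.
by apply: le_trans br; have [_] := Cy tt; rewrite /= enorm_le.
Qed.

Lemma proj_in p : A (proj A p). Proof. exact: (proj_spec p).1. Qed.

Lemma proj_obtuse p q : A q -> dot (p - proj A p) (q - proj A p) <= 0.
Proof.
move=> Aq; have [Ap pmin] := proj_spec p.
rewrite -oppr_ge0 -(pmulr_rge0 _ (ltr0n R 2)).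
apply: (@slope_ge0 _ _ (dot (q - proj A p) (q - proj A p))).
move=> t /andP[t0 t1]; have t01 : 0 <= t <= 1 by rewrite ltW.
have := pmin _ ((convex_setP _).1 A_convex _ _ _ Ap Aq t01).
rewrite enorm_le ?enorm_ge0// enorm_sqr opprD addrA [leRHS]dotBB.
rewrite !dotZr !dotZl; lra.
Qed.

Lemma proj_firmly_nonexpansive p q :
  dot (proj A p - proj A q) (proj A p - proj A q) <=
  dot (proj A p - proj A q) (p - q).
Proof.
have := proj_obtuse p (proj_in q); have := proj_obtuse q (proj_in p).
rewrite !(dotBl, dotBr) (dotC p (proj A p)) (dotC p (proj A q)).
rewrite (dotC q (proj A p)) (dotC q (proj A q)) (dotC (proj A q) (proj A p)).
lra.
Qed.

Lemma proj_nonexpansive p q : enorm (proj A p - proj A q) <= enorm (p - q).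
Proof.
have := proj_firmly_nonexpansive p q; set u := proj A p - proj A q => uu.
have [->|u0] := eqVneq u 0; first by rewrite enorm_le ?enorm_ge0// dot0l sqr_ge0.
have eu : 0 < enorm u by rewrite lt_def enorm_eq0 u0 enorm_ge0.
by rewrite -(ler_pM2l eu) -expr2 enorm_sqr (le_trans uu)// cauchy_schwarz.
Qed.

Definition half_sqdist p := 2^-1 * dot (p - proj A p) (p - proj A p).

Lemma half_sqdist_le p q : A q -> half_sqdist p <= 2^-1 * dot (p - q) (p - q).
Proof.
move=> Aq; rewrite ler_pM2l// -!enorm_sqr ler_sqr ?nnegrE ?enorm_ge0//.
exact: (proj_spec p).2.
Qed.

(** Half the squared distance to a convex set is differentiable although the
    projection need not be.  Each of the two bounds compares the distance of
    one point with the projection of the other. *)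
Lemma half_sqdist_expansion p q :
  `|half_sqdist q - half_sqdist p - dot (p - proj A p) (q - p)| <=
    2^-1 * dot (q - p) (q - p).
Proof.
have := half_sqdist_le q (proj_in p); have := half_sqdist_le p (proj_in q).
have -> : p - proj A q = (q - proj A q) - (q - p).
  by apply/rowP => k; rewrite !mxE; ring.
have -> : q - proj A p = (q - p) + (p - proj A p) by rewrite subrKA.
rewrite [dot (_ + _ - _) _]dotBB [dot (_ - _ + (_ - _)) _]dotDD.
rewrite (dotC (q - p) (p - proj A p)) => lo up.
have := proj_firmly_nonexpansive q p; set u := proj A q - proj A p => uu.
have := dot_ge0 ((q - p) - u); rewrite dotBB (dotC (q - p) u) => vu.
have : dot (q - proj A q) (q - p) - dot (p - proj A p) (q - p) =
    dot (q - p) (q - p) - dot u (q - p).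
  by rewrite -!dotBl; congr dot; rewrite /u opprB; apply/rowP => k; rewrite !mxE; ring.
rewrite ler_norml; rewrite /half_sqdist in lo up *; lra.
Qed.

End Projection.

(** * Chain rule along trajectories *)

Section Slopes.
Variables (R : realType) (n : nat).
Implicit Types (g h : R -> R) (x : R -> 'rV[R]_n) (t : R).

Lemma has_slopeD g h t a b : has_slope g t a -> has_slope h t b ->
  has_slope (fun u => g u + h u) t (a + b).
Proof.
move=> ga hb e e0; have e2 : 0 < e / 2 by rewrite divr_gt0.
have [r r0 gr] := ga _ e2; have [s s0 hs] := hb _ e2.
exists (Num.min r s); first by rewrite lt_min r0.
move=> u; rewrite lt_min => /andP[/gr gu /hs hu].
have -> : g u + h u - (g t + h t) - (a + b) * (u - t) =
  (g u - g t - a * (u - t)) + (h u - h t - b * (u - t)) by ring.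
by rewrite (le_trans (ler_normD _ _))// (le_trans (lerD gu hu))//; lra.
Qed.

Lemma has_slopeZ g t a c : has_slope g t a ->
  has_slope (fun u => c * g u) t (c * a).
Proof.
move=> ga e e0; have c0 : 0 < `|c| + 1 by rewrite ltr_wpDl.
have [r r0 gr] := ga _ (divr_gt0 e0 c0); exists r => // u /gr gu.
rewrite -mulrBr -mulrA -mulrBr normrM.
have N0 := normr_ge0 (g u - g t - a * (u - t)).
rewrite (@le_trans _ _ ((`|c| + 1) * `|g u - g t - a * (u - t)|))//; first nra.
by rewrite -ler_pdivlMl// mulrA (mulrC _ e).
Qed.

Lemma has_slope_linear c t : has_slope (fun u => c * u) t c.
Proof.
move=> e e0; exists 1 => // u _.
by rewrite -mulrBr subrr normr0 mulr_ge0// ltW.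
Qed.

Lemma has_slope_sum (I : finType) (g : I -> R -> R) t (a : I -> R) :
  (forall i, has_slope (g i) t (a i)) ->
  has_slope (fun u => \sum_i g i u) t (\sum_i a i).
Proof.
move=> ga; elim: (index_enum I) => [|i r IH].
  move=> e e0; exists 1 => // u _.
  by rewrite !big_nil subrr mul0r subrr normr0 mulr_ge0// ltW.
rewrite big_cons; under [X in has_slope X]funext do rewrite big_cons.
exact: has_slopeD.
Qed.

Lemma is_derive_approx x t l : is_derive t 1 x l -> forall e : R, 0 < e ->
  exists2 r : R, 0 < r & forall u, `|u - t| < r ->
    enorm (x u - x t - (u - t) *: l) <= e * `|u - t|.
Proof.
move=> [dx xl] e e0.
have d0 : 0 < n%:R + 1 :> R by rewrite ltr_wpDl.
have := dx; rewrite /derivable => /cvg_ex[l' ll'].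
have : l' = l by rewrite -xl; symmetry; exact: cvg_lim.
move=> ?; subst l'.
have /cvgrPdist_le/(_ _ (divr_gt0 e0 d0)) := ll'.
rewrite /dnbhs /within/= => /nbhs_ballP[r /= r0 rP].
exists r => // u ur; have [->|ut] := eqVneq u t.
  by rewrite !subrr scale0r subrr normr0 mulr0 enorm_le ?dot0l ?expr0n.
have ut0 : u - t != 0 by rewrite subr_eq0.
have := rP (u - t); rewrite /ball/= sub0r normrN => /(_ ur ut0).
rewrite scaler1 subrK => h.
rewrite (le_trans (enorm_le_norm _))//.
have -> : x u - x t - (u - t) *: l =
    - ((u - t) *: (l - (u - t)^-1 *: (x u - x t))).
  by rewrite scalerBr scalerA divff// scale1r opprB.
rewrite normrN normrZ mulrCA mulrC ler_wpM2r//.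
rewrite (@le_trans _ _ ((n%:R + 1) * (e / (n%:R + 1))))//.
  by rewrite ler_pM// lerDl.
by rewrite mulrC divfK// gt_eqF.
Qed.

Lemma has_slope_comp (F : 'rV[R]_n -> R) x t l v (C : R) : 0 <= C ->
  (forall q, `|F q - F (x t) - dot v (q - x t)| <= C * dot (q - x t) (q - x t)) ->
  is_derive t 1 x l -> has_slope (fun u => F (x u)) t (dot v l).
Proof.
move=> C0 Fv xl e e0.
pose L := enorm l + 1; have L0 : 0 < L by rewrite ltr_wpDl ?enorm_ge0.
have V0 : 0 < enorm v + 1 by rewrite ltr_wpDl ?enorm_ge0.
have K0 : 0 < C * L ^+ 2 + 1 by rewrite ltr_wpDl// mulr_ge0// sqr_ge0.
have [r1 r10 x1] := is_derive_approx xl ltr01.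
have e2 : 0 < e / 2 by rewrite divr_gt0.
have [r2 r20 x2] := is_derive_approx xl (divr_gt0 e2 V0).
exists (Num.min (Num.min r1 r2) (e / 2 / (C * L ^+ 2 + 1))).
  by rewrite !lt_min r10 r20 divr_gt0.
move=> u; rewrite !lt_min ltr_pdivlMr// => /andP[/andP[/x1 u1 /x2 u2]].
set s := `|u - t| in u1 u2 * => us.
have s0 : 0 <= s by exact: normr_ge0.
have xL : enorm (x u - x t) <= L * s.
  rewrite -(subrK ((u - t) *: l) (x u - x t)) (le_trans (ler_enormD _ _))//.
  by rewrite enormZ -/s /L; lra.
have := Fv (x u).
have := cauchy_schwarz_norm v (x u - x t - (u - t) *: l).
rewrite (dotBr v (x u - x t)) dotZr => h1 h2.
have h3 : `|dot v (x u - x t) - (u - t) * dot v l| <= e / 2 * s.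
  rewrite (le_trans h1)// (@le_trans _ _ ((enorm v + 1) * (e / 2 / (enorm v + 1) * s)))//.
    by rewrite ler_pM ?enorm_ge0// lerDl.
  by rewrite mulrA mulrCA divff ?mulr1// gt_eqF.
have h4 : C * dot (x u - x t) (x u - x t) <= e / 2 * s.
  rewrite (@le_trans _ _ (C * (L * s) ^+ 2))//.
    rewrite ler_wpM2l// -enorm_le// mulr_ge0// ltW//.
  rewrite exprMn mulrA expr2 mulrA ler_wpM2r//.
  by rewrite mulrC; lra.
have -> : F (x u) - F (x t) - dot v l * (u - t) =
  (F (x u) - F (x t) - dot v (x u - x t)) +
  (dot v (x u - x t) - (u - t) * dot v l) by ring.
by rewrite (le_trans (ler_normD _ _))//; lra.
Qed.

End Slopes.

(** * The graph Laplacian *)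

Section Laplacian.
Variables (R : realType) (N : nat) (a : 'M[R]_N).
Hypothesis a_ge0 : forall i j, 0 <= a i j.
Hypothesis a_undirected : undirected a.
Hypothesis a_connected : connected_graph a.
Implicit Types u v : 'rV[R]_N.

Notation L := (laplacian a).
Notation one := (const_mx 1 : 'rV[R]_N).

Lemma dot_mulmx n (A : 'M[R]_n) (p q : 'rV[R]_n) :
  dot p (q *m A) = dot (p *m A^T) q.
Proof.
have dotE (p' q' : 'rV[R]_n) : dot p' q' = (p' *m q'^T) 0 0.
  by rewrite mxE; apply: eq_bigr => k _; rewrite mxE.
by rewrite !dotE trmx_mul mulmxA.
Qed.

Lemma laplacian_tr : L^T = L.
Proof.
rewrite /laplacian linearB/= tr_diag_mx; congr (_ - _).
by apply/matrixP => i j; rewrite mxE a_undirected.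
Qed.

Lemma mul_laplacian u i :
  (u *m L) 0 i = \sum_j a i j * (u 0 i - u 0 j).
Proof.
rewrite /laplacian mulmxBr mul_mx_diag !mxE mulr_sumr -sumrB.
by apply: eq_bigr => j _; rewrite (a_undirected j); ring.
Qed.

Lemma one_laplacian : one *m L = 0.
Proof.
apply/rowP => i; rewrite mul_laplacian [RHS]mxE big1// => j _.
by rewrite !mxE subrr mulr0.
Qed.

Lemma laplacian_mean0 u : dot (u *m L) one = 0.
Proof. by rewrite dotC dot_mulmx laplacian_tr one_laplacian dot0l. Qed.

Lemma laplacian_form u :
  dot u (u *m L) = 2^-1 * \sum_i \sum_j a i j * (u 0 i - u 0 j) ^+ 2.
Proof.
pose S := \sum_i \sum_j a i j * (u 0 i * (u 0 i - u 0 j)).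
have -> : dot u (u *m L) = S.
  apply: eq_bigr => i _; rewrite mul_laplacian mulr_sumr.
  by apply: eq_bigr => j _; ring.
have S2 : S = \sum_i \sum_j a i j * (u 0 j * (u 0 j - u 0 i)).
  rewrite /S exchange_big/=; apply: eq_bigr => i _; apply: eq_bigr => j _.
  by rewrite a_undirected.
have -> : \sum_i \sum_j a i j * (u 0 i - u 0 j) ^+ 2 = S + S.
  rewrite {2}S2 -big_split/=; apply: eq_bigr => i _.
  by rewrite -big_split/=; apply: eq_bigr => j _; ring.
by lra.
Qed.

Lemma laplacian_form_ge0 u : 0 <= dot u (u *m L).
Proof.
rewrite laplacian_form mulr_ge0 ?invr_ge0//.
by do 2!(apply: sumr_ge0 => ? _); rewrite mulr_ge0 ?sqr_ge0.
Qed.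

Lemma laplacian_form_eq0 u : dot u (u *m L) = 0 -> forall i j, u 0 i = u 0 j.
Proof.
rewrite laplacian_form => /eqP; rewrite mulf_eq0 invr_eq0 pnatr_eq0/= => /eqP u0.
have T0 i j : true -> 0 <= a i j * (u 0 i - u 0 j) ^+ 2.
  by move=> _; rewrite mulr_ge0 ?sqr_ge0.
have S0 i : true -> 0 <= \sum_j a i j * (u 0 i - u 0 j) ^+ 2.
  by move=> _; apply: sumr_ge0 => j; exact: T0.
have edge i j : 0 < a i j -> u 0 i = u 0 j.
  move=> aij.
  have /(_ i isT) Si := psumr_eq0P S0 u0.
  have /(_ j isT)/eqP := psumr_eq0P (T0 i) Si.
  by rewrite mulf_eq0 gt_eqF//= sqrf_eq0 subr_eq0 => /eqP.
move=> i j; have /connectP[p + ->] := a_connected i j.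
by elim: p i => //= k p IH i /andP[/edge -> /IH].
Qed.

Lemma laplacian_kernel u : u *m L = 0 -> forall i j, u 0 i = u 0 j.
Proof. by move=> u0; apply: laplacian_form_eq0; rewrite u0 dot0r. Qed.

(** The range of a symmetric matrix is the orthogonal complement of its kernel,
    which consists of the constants as the graph is connected. *)
Lemma laplacian_range v : dot v one = 0 -> exists u, u *m L = v.
Proof.
move=> v0; suff /submxP[u ->] : (v <= L)%MS by exists u.
rewrite submxE; apply/eqP/rowP => k; rewrite !mxE.
have ck i j : (cokermx L) i k = (cokermx L) j k.
  have := @laplacian_kernel (row k (cokermx L)^T) _ i j.
  rewrite !mxE; apply; apply: trmx_inj; rewrite trmx_mul laplacian_tr.
  rewrite tr_row trmxK; apply/matrixP => i' j'.
  have := mulmx_coker L => /matrixP/(_ i' k); rewrite !mxE => h.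
  by rewrite -[RHS]h; apply: eq_bigr => l _; rewrite !mxE.
have [N0|[i0]] : N = 0%N \/ inhabited 'I_N.
- by case: (N) => [|m]; [left | right; constructor; exact: ord0].
- by rewrite big1// => i; have := ltn_ord i; rewrite {2}N0.
- under eq_bigr => i _ do rewrite (ck i i0).
  have v0' : \sum_i v 0 i = 0.
    by rewrite -[RHS]v0; apply: eq_bigr => i _; rewrite mxE mulr1.
  by rewrite -mulr_suml v0' mul0r.
Qed.

Section Rayleigh.
Variable lambda2 : R.
Hypothesis hlambda2 : smallest_positive_eigenvalue L lambda2.

(** The minimum [mu] of the quadratic form on unit vectors orthogonal to the
    constants is attained at some [v0].  The gradient [h] of the Rayleigh
    quotient at [v0] is itself orthogonal to the constants, so moving along [h]
    would decrease the form unless [h = 0]; hence [mu] is an eigenvalue, and it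
    is positive because the graph is connected. *)
Lemma laplacian_rayleigh u :
  dot u one = 0 -> lambda2 * dot u u <= dot u (u *m L).
Proof.
move=> u1; have [->|u0] := eqVneq u 0; first by rewrite !dot0l mulr0.
have [G [UG oG]] := nat_ultrafilter.
pose C (_ : unit) := [set v : 'rV[R]_N | dot v v = 1 /\ dot v one = 0].
pose unit_of v := (enorm v)^-1 *: v.
have Cunit v : v != 0 -> dot v one = 0 -> C tt (unit_of v).
  move=> v0 v1; split; rewrite /unit_of dotZl ?v1 ?mulr0// dotZr -enorm_sqr.
  by have := v0; rewrite -enorm_eq0 => ?; field.
have vv v : (x : 'rV[R]_N) @[x --> v] --> v by exact: cvg_id.
have Ccl i : closed (C i).
  apply: closedI.
    exact: (@closed_comp _ _ (fun v : 'rV[R]_N => dot v v) [set 1]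
      (fun v _ => cvg_dot (vv v) (vv v)) (@closed_eq _ 1)).
  exact: (@closed_comp _ _ (fun v : 'rV[R]_N => dot v one) [set 0]
    (fun v _ => cvg_dot (vv v) (cvg_cst one)) (@closed_eq _ 0)).
have [|||y [/(_ tt)[yy y1] ymin]] := @product_minimizer R N G UG oG unit C 1
    (fun y => dot (y tt) (y tt *m L)) Ccl.
- by move=> i v [v1 _]; rewrite enorm_le// v1 expr1n.
- move=> y l _ _ /(_ tt) yl; rewrite laplacian_form.
  under eq_fun do rewrite laplacian_form.
  apply: cvgM; first exact: cvg_cst.
  do 2!(apply: cvg_sum => ? _); apply: cvgM; first exact: cvg_cst.
  have yi i : (y k tt 0 i) @[k --> G] --> l tt 0 i.
    exact: (cvg_comp _ _ yl (@coord_continuous _ _ _ 0 i (l tt))).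
  by rewrite expr2; under eq_fun do rewrite expr2; apply: cvgM; apply: cvgB.
- by exists (fun=> unit_of u) => -[]; exact: Cunit.
pose v0 := y tt; rewrite -/v0 in yy y1 ymin.
set mu := dot v0 (v0 *m L) in ymin.
have muP v : dot v one = 0 -> mu * dot v v <= dot v (v *m L).
  move=> v1; have [->|vn0] := eqVneq v 0; first by rewrite !dot0l mulr0.
  have ev : 0 < dot v v by rewrite dot_gt0.
  have := ymin (fun=> unit_of v) (fun=> Cunit _ vn0 v1).
  rewrite /unit_of -scalemxAl dotZl dotZr mulrA -invfM -expr2 enorm_sqr.
  by rewrite mulrC ler_pdivlMr.
have [h hE] : exists h, h = v0 *m L - mu *: v0 by eexists.
have h1 : dot h one = 0 by rewrite hE dotBl laplacian_mean0 dotZl y1 mulr0 subrr.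
have hh : 0 <= - (2 * dot h h).
  apply: (@slope_ge0 _ _ (dot h (h *m L) - mu * dot h h)).
  move=> t _; have v1 : dot (v0 - t *: h) one = 0.
    by rewrite dotBl dotZl y1 h1 mulr0 subrr.
  have := muP _ v1; rewrite -subr_ge0; congr (0 <= _).
  rewrite mulmxBl -scalemxAl dotBB yy !(dotBl, dotBr, dotZl, dotZr).
  have hv : dot h (v0 *m L) = dot v0 (h *m L).
    by rewrite dot_mulmx laplacian_tr dotC dot_mulmx laplacian_tr dotC.
  rewrite -/mu hv.
  have E : dot v0 (h *m L) - mu * dot v0 h = dot h h.
    by rewrite -hv [dot v0 h]dotC -dotZr -dotBr -hE.
  by rewrite -E; ring.
have h0 : v0 *m L = mu *: v0.
  apply/eqP; rewrite -subr_eq0 -dot_eq0 eq_le dot_ge0 andbT -hE; lra.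
have v0n0 : v0 != 0 by rewrite -dot_eq0 yy oner_eq0.
have mu0 : 0 < mu.
  rewrite lt_def laplacian_form_ge0 andbT; apply: contra v0n0 => /eqP mu0.
  have vc := laplacian_form_eq0 mu0.
  apply/eqP/rowP => i; rewrite mxE.
  have : dot v0 one = v0 0 i * N%:R.
    rewrite mulr_natr -[X in _ *+ X]card_ord -sumr_const.
    by apply: eq_bigr => j _; rewrite mxE mulr1 (vc j i).
  rewrite y1 => /esym/eqP; rewrite mulf_eq0 pnatr_eq0 => /orP[/eqP//|/eqP N0].
  by have := ltn_ord i; rewrite {2}N0.
rewrite (le_trans _ (muP _ u1))// ler_wpM2r ?dot_ge0//.
have [_ _ lmin] := hlambda2; apply: lmin => //; apply/eigenvalueP.
by exists v0.
Qed.

Lemma lambda2_le_spectral_norm : lambda2 <= spectral_norm L.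
Proof.
have [/eigenvalueP[v vL v0] l0 _] := hlambda2.
have ev : 0 < enorm v by rewrite lt_def enorm_eq0 v0 enorm_ge0.
apply: ub_le_sup; last first.
  exists ((enorm v)^-1 *: v).
    by rewrite /= enormZ gtr0_norm ?invr_gt0// mulVf// gt_eqF.
  rewrite laplacian_tr -scalemxAl vL !enormZ gtr0_norm ?invr_gt0//.
  by rewrite gtr0_norm// mulrCA mulVf ?mulr1// gt_eqF.
exists (N%:R * \sum_i \sum_j `|L^T i j|) => _ [u /= u1 <-].
rewrite (le_trans (enorm_le_norm _))// ler_wpM2l//.
rewrite [leLHS]/Num.norm/= mx_normrE; apply/bigmax_leP; split=> [|[i k] _ /=].
  by do 2!(apply: sumr_ge0 => ? _).
rewrite mxE (le_trans (ler_norm_sum _ _ _))//; apply: ler_sum => j _.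
rewrite normrM ord1 (@le_trans _ _ (1 * `|L^T j k|))//.
  by rewrite ler_wpM2r// (le_trans (coord_le_enorm _ _)).
by rewrite mul1r (bigD1 k)//= lerDl sumr_ge0.
Qed.

End Rayleigh.
End Laplacian.

(** * Decrease of the Lyapunov function *)

Section Diffusion.
Variables (R : realType) (N n : nat) (a : 'M[R]_N).
Hypothesis a_ge0 : forall i j, 0 <= a i j.
Hypothesis a_undirected : undirected a.
Hypothesis a_connected : connected_graph a.
Implicit Types u v w : 'I_N -> 'rV[R]_n.

Notation L := (laplacian a).
Notation diffuse := (@diffuse R N n a).

Let coord u k : 'rV[R]_N := \row_i u i 0 k.

Let diffuse_coord u k : coord (diffuse u) k = coord u k *m L.
Proof.
apply/rowP => i; rewrite mul_laplacian// mxE summxE.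
by apply: eq_bigr => j _; rewrite !mxE.
Qed.

Let sum_dot_coord u v :
  \sum_i dot (u i) (v i) = \sum_k dot (coord u k) (coord v k).
Proof.
rewrite exchange_big/=; apply: eq_bigr => k _; apply: eq_bigr => i _.
by rewrite !mxE.
Qed.

Lemma diffuse_sym u v :
  \sum_i dot (u i) (diffuse v i) = \sum_i dot (diffuse u i) (v i).
Proof.
rewrite !sum_dot_coord; apply: eq_bigr => k _.
by rewrite !diffuse_coord dot_mulmx laplacian_tr.
Qed.

Lemma diffuseB u v i : diffuse (fun j => u j - v j) i = diffuse u i - diffuse v i.
Proof.
rewrite /Defs.diffuse -sumrB; apply: eq_bigr => j _.
by rewrite -scalerBr !opprB addrACA [- v i + _]addrC addrACA [v j - v i]addrC.
Qed.

Lemma diffuse_cst (p : 'rV[R]_n) i : diffuse (fun=> p) i = 0.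
Proof. by rewrite /Defs.diffuse big1// => j _; rewrite subrr scaler0. Qed.

Lemma diffuseN u i : \sum_j a i j *: (u j - u i) = - diffuse u i.
Proof. by rewrite -sumrN; apply: eq_bigr => j _; rewrite -scalerN opprB. Qed.

Lemma sum_dot_diffuse (p : 'rV[R]_n) u : \sum_i dot p (diffuse u i) = 0.
Proof.
rewrite (diffuse_sym (fun=> p)) big1// => i _.
by rewrite diffuse_cst dot0l.
Qed.

Lemma diffuse_surj v : \sum_i v i = 0 -> exists w, forall i, diffuse w i = v i.
Proof.
move=> v0; have vk k : dot (coord v k) (const_mx 1) = 0.
  transitivity ((\sum_i v i) 0 k); last by rewrite v0 mxE.
  by rewrite summxE; apply: eq_bigr => i _; rewrite !mxE mulr1.
have /choice[W WP] : forall k, exists p, p *m L = coord v k.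
  by move=> k; apply: laplacian_range.
exists (fun i => \row_k W k 0 i) => i; apply/rowP => k.
have := diffuse_coord (fun i => \row_k W k 0 i) k => /rowP/(_ i).
rewrite mxE => ->; rewrite (_ : coord _ k = W k) ?WP ?mxE//.
by apply/rowP => j; rewrite !mxE.
Qed.

Section SpectralGap.
Variable lambda2 : R.
Hypothesis hlambda2 : smallest_positive_eigenvalue L lambda2.
Hypothesis N_gt0 : (0 < N)%N.

Lemma diffuse_gap u : exists m : 'rV[R]_n,
  lambda2 * \sum_i dot (u i - m) (u i - m) <= \sum_i dot (u i) (diffuse u i).
Proof.
pose m := N%:R^-1 *: \sum_i u i; exists m.
have N0 : N%:R != 0 :> R by rewrite pnatr_eq0 -lt0n.
have um : \sum_i (u i - m) = 0.
  by rewrite sumrB sumr_const card_ord -scaler_nat /m scalerA divff// scale1r subrr.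
have -> : \sum_i dot (u i) (diffuse u i) =
    \sum_i dot (u i - m) (diffuse (fun j => u j - m) i).
  under [RHS]eq_bigr do rewrite diffuseB diffuse_cst subr0 dotBl.
  by rewrite sumrB sum_dot_diffuse subr0.
rewrite !sum_dot_coord mulr_sumr; apply: ler_sum => k _.
rewrite diffuse_coord; apply: laplacian_rayleigh => //.
transitivity ((\sum_i (u i - m)) 0 k); last by rewrite um mxE.
by rewrite summxE; apply: eq_bigr => i _; rewrite !mxE mulr1.
Qed.

Variables (omega k1 k2 k3 : R).
Hypothesis omega_gt0 : 0 < omega.
Hypothesis hk1 : spectral_norm L ^+ 2 / (lambda2 ^+ 2 * omega) < k1.
Hypothesis hk2 : k1 ^+ 2 * spectral_norm L ^+ 2 / lambda2 ^+ 3 < k2.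
Hypothesis hk3 : 0 < k3.

(** The two gain conditions combine into one comparison once the spectral norm
    is bounded below by [lambda2]. *)
Lemma gains : 0 < k1 /\ k1 < omega * (k2 * lambda2).
Proof.
have [_ l0 _] := hlambda2.
have lS := lambda2_le_spectral_norm a_undirected hlambda2.
have h1 := hk1; have h2 := hk2; set S := spectral_norm L in lS h1 h2.
have l2 : 0 < lambda2 ^+ 2 by rewrite exprn_gt0.
have lS2 : lambda2 ^+ 2 <= S ^+ 2.
  by rewrite ler_sqr ?nnegrE ?(ltW l0)// (le_trans (ltW l0)).
have k10 : 0 < k1.
  by apply: le_lt_trans h1; rewrite divr_ge0 ?sqr_ge0// mulr_ge0 ?ltW.
have k1w : 1 < k1 * omega.
  rewrite ltr_pdivrMr ?mulr_gt0// mulrCA in h1.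
  have := le_lt_trans lS2 h1; rewrite -{1}(mulr1 (lambda2 ^+ 2)).
  by rewrite ltr_pM2l.
have k1k2 : k1 ^+ 2 < k2 * lambda2.
  rewrite ltr_pdivrMr ?exprn_gt0// in h2.
  have : k1 ^+ 2 * lambda2 ^+ 2 < k2 * lambda2 * lambda2 ^+ 2.
    rewrite -mulrA -exprS; apply: le_lt_trans h2.
    by rewrite ler_pM2l ?exprn_gt0.
  by rewrite ltr_pM2r.
split=> //.
have : omega * k1 ^+ 2 < omega * (k2 * lambda2) by rewrite ltr_pM2l.
apply: le_lt_trans.
by rewrite expr2 mulrCA -{1}(mulr1 k1) ler_pM2l// mulrC ltW.
Qed.

(** Here [y], [s], [w] are the deviations from an equilibrium and [s'], [w'] the
    velocities.  Put [e i = diffuse w i].  The terms [dot (y i) (s i)] cancel,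
    and what is left of [s] pairs with [e], which sums to zero, so that [s] may
    be replaced by its deviation from its mean [m].  The spectral gap then
    controls [dot (s i - m) (e i)] at the price of [omega / 4 * |e i|^2]. *)
Lemma lyapunov_decrease (y s w s' w' : 'I_N -> 'rV[R]_n) :
  let r i := diffuse w i - y i in
  (forall i, s' i = k1 *: r i - k2 *: diffuse s i) ->
  (forall i, w' i = - (k3 *: diffuse r i)) ->
  \sum_i (dot (y i) (s i) + k1^-1 * dot (s i) (s' i) +
          2 * omega / k3 * dot (w i) (w' i)) <=
  3 / 4 * omega * \sum_i dot (y i) (y i).
Proof.
move=> r s'E w'E.
have [k10 k1k2] := gains; have [_ l0 _] := hlambda2.
have [m sm] := diffuse_gap s.
pose e := diffuse w.
pose kappa := k2 * lambda2 / k1.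
have kl0 : 0 < k2 * lambda2 by rewrite -(pmulr_rgt0 _ omega_gt0) (lt_trans k10).
have kappa0 : 0 < kappa by rewrite divr_gt0.
have kappaV : kappa^-1 <= omega.
  by rewrite invf_div ler_pdivrMr// ltW.
have -> : \sum_i (dot (y i) (s i) + k1^-1 * dot (s i) (s' i) +
          2 * omega / k3 * dot (w i) (w' i)) =
  \sum_i dot (s i) (e i) - k2 / k1 * \sum_i dot (s i) (diffuse s i) -
  2 * omega * \sum_i dot (e i) (r i).
  rewrite -(diffuse_sym w r) !mulr_sumr -!sumrB; apply: eq_bigr => i _.
  rewrite s'E w'E dotBr dotNr !dotZr dotBr -/(e i) (dotC (s i) (y i)).
  by field; rewrite !gt_eqF.
have -> : \sum_i dot (s i) (e i) = \sum_i dot (s i - m) (e i).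
  under [RHS]eq_bigr do rewrite dotBl.
  by rewrite sumrB sum_dot_diffuse subr0.
have k2k1 : k2 / k1 * \sum_i dot (s i) (diffuse s i) >=
    kappa * \sum_i dot (s i - m) (s i - m).
  have k20 : 0 < k2 by rewrite -(pmulr_lgt0 _ l0).
  have -> : kappa = k2 / k1 * lambda2 by rewrite /kappa mulrAC.
  by rewrite -mulrA ler_pM2l ?divr_gt0.
suff : \sum_i dot (s i - m) (e i) - kappa * \sum_i dot (s i - m) (s i - m) -
    2 * omega * \sum_i dot (e i) (r i) <= 3 / 4 * omega * \sum_i dot (y i) (y i).
  by lra.
rewrite !mulr_sumr -!sumrB; apply: ler_sum => i _.
have c0 : 0 < (2 * kappa)^-1 by rewrite invr_gt0 mulr_gt0.
have := dot_young (s i - m) (e i) c0; rewrite invrK invfM.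
have := ler_wpM2r (dot_ge0 (e i)) kappaV.
(* [3 / 4] leaves [omega / 4] out of [omega] for [y], and its inverse [4 / 3] is
   below the weight [2 - 1 / 4] that is left for [e] *)
have c1 : 0 < 3 / 4 :> R by [].
have := ler_wpM2l (ltW omega_gt0) (dot_young (e i) (y i) c1).
have := mulr_ge0 (ltW omega_gt0) (dot_ge0 (e i)).
rewrite /r -/(e i) (dotBr (e i)) (_ : (3 / 4)^-1 = 4 / 3 :> R); last by field.
lra.
Qed.


End SpectralGap.
End Diffusion.

(** * Estimates along absolutely continuous trajectories *)

Section Trajectories.
Variable R : realType.

Lemma abs_continuous_sub (V : normedModType R) (b c b' c' : R) (g : R -> V) :
  b <= b' -> c' <= c -> abs_continuous_on b c g -> abs_continuous_on b' c' g.
Proof.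
move=> bb' cc' gac e /gac[dl dl0 gd]; exists dl => // m u v uv.
by apply: gd => k; have [? ? ?] := uv k; split=> //; lra.
Qed.

(** Steps of length [dl / 2] change the function by less than 1 each. *)
Lemma abs_continuous_bounded (V : normedModType R) (T : R) (h : R -> V) :
  abs_continuous_on 0 T h -> exists B, forall t, 0 <= t <= T -> `|h t| <= B.
Proof.
move=> hac; have [dl dl0 hd] := hac 1 ltr01.
have step u v : 0 <= u -> u <= v -> v <= T -> v - u < dl -> `|h v - h u| < 1.
  move=> u0 uv vT uvd; have := hd 1%N (fun=> u) (fun=> v).
  rewrite !big_ord1; apply=> // i j; by rewrite !ord1 eqxx.
have dl2 : 0 < dl / 2 by rewrite divr_gt0.
have bound m t : 0 <= t <= T -> t <= m%:R * (dl / 2) -> `|h t - h 0| <= m%:R.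
  elim: m t => [|m IH] t /andP[t0 tT].
    by rewrite mul0r => t0'; rewrite (le_anti (introT andP (conj t0' t0))) subrr normr0.
  rewrite -natr1 mulrDl mul1r => tm.
  have [td|dt] := leP t (dl / 2).
    have : `|h t - h 0| < 1 by apply: step => //; lra.
    by move=> /ltW/le_trans; apply; rewrite lerDr.
  have IHt : `|h (t - dl / 2) - h 0| <= m%:R by apply: IH; lra.
  have : `|h t - h (t - dl / 2)| < 1 by apply: step => //; lra.
  move=> /ltW ht; rewrite -(subrKA (h (t - dl / 2))).
  by rewrite (le_trans (ler_normD _ _))// addrC lerD.
have [m mT] : exists m : nat, T <= m%:R * (dl / 2).
  have [m _ mP] := nbhs_infty_ger (T / (dl / 2)).
  by exists m; have := mP m (leqnn m); rewrite /= ler_pdivrMr.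
exists (m%:R + `|h 0|) => t tT.
rewrite -(subrK (h 0) (h t)) (le_trans (ler_normD _ _))// lerD2r bound//.
by apply: le_trans mT; case/andP: tT.
Qed.

Lemma slope_bound (g : R -> R) (P : R -> Prop) (b c M : R) :
  locally_abs_continuous g -> {ae @lebesgue_measure R, forall t, P t} ->
  0 <= b -> b <= c ->
  (forall t, b < t -> t < c -> P t -> exists2 l, l <= M & has_slope g t l) ->
  g c - g b <= M * (c - b).
Proof.
move=> gac aeP b0 bc gP.
have c0 : 0 < c + 1 by lra.
have /abs_continuous_sub gac' := gac _ c0.
have {gac'} gac' : abs_continuous_on b c g by apply: gac' => //; lra.
suff : g c + - M * c <= g b + - M * b by lra.
apply: (@abs_continuous_nonincreasing _ (fun t => g t + - M * t) b c
  (~` [set t | P t]) bc) => //.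
  apply: (@abs_continuous_dominated _ _ _ _ _ g _ 1 `|M| ler01 (normr_ge0 _) gac').
  move=> u v bu uv vc; rewrite mul1r.
  have -> : g v + - M * v - (g u + - M * u) = (g v - g u) - M * (v - u) by ring.
  rewrite (le_trans (ler_normB _ _))// lerD2l normrM (@ger0_norm _ (v - u))//.
  by rewrite subr_ge0.
move=> t bt tc /contrapT Pt; have [l lM gl] := gP t bt tc Pt.
exists (l + - M); first lra.
exact: has_slopeD gl (@has_slope_linear _ _ _).
Qed.

Lemma locally_abs_continuousD (g h : R -> R) : locally_abs_continuous g ->
  locally_abs_continuous h -> locally_abs_continuous (fun t => g t + h t).
Proof. by move=> gac hac T T0; apply: abs_continuousD; [exact: gac|exact: hac]. Qed.

Lemma locally_abs_continuousZ (k : R) (g : R -> R) : locally_abs_continuous g ->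
  locally_abs_continuous (fun t => k * g t).
Proof.
move=> gac T T0; apply: (@abs_continuous_dominated _ _ _ _ _ g _ `|k| 0) => //.
  exact: gac.
by move=> u v _ _ _; rewrite mul0r addr0 -mulrBr normrM.
Qed.

Lemma locally_abs_continuous_sum (I : finType) (g : I -> R -> R) :
  (forall i, locally_abs_continuous (g i)) ->
  locally_abs_continuous (fun t => \sum_i g i t).
Proof.
move=> gac; elim: (index_enum I) => [|i r IH].
  move=> T _ e e0; exists 1 => // m u v _ _ _; rewrite big1// => k _.
  by rewrite !big_nil subrr normr0.
under [X in locally_abs_continuous X]funext do rewrite big_cons.
exact: (locally_abs_continuousD (gac i) IH).
Qed.

Variable n : nat.
Implicit Types (F : 'rV[R]_n -> R) (v : 'rV[R]_n -> 'rV[R]_n).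
Implicit Types (x : R -> 'rV[R]_n) (p q : 'rV[R]_n).

Definition quadratic_expansion F v := forall p q,
  `|F q - F p - dot (v p) (q - p)| <= 2^-1 * dot (q - p) (q - p).

Lemma locally_abs_continuous_comp F v x (A : R) : quadratic_expansion F v ->
  (forall p, enorm (v p) <= A + enorm p) ->
  locally_abs_continuous x -> locally_abs_continuous (fun t => F (x t)).
Proof.
move=> Fv vA xac T T0; have [B xB] := abs_continuous_bounded (xac T T0).
have B0 : 0 <= B by rewrite (le_trans _ (xB 0 _))// lexx ltW.
have nB0 : 0 <= n%:R * B by rewrite mulr_ge0.
have A0 : 0 <= A + n%:R * B.
  rewrite (le_trans (enorm_ge0 (v (x 0))))// (le_trans (vA _))// lerD2l.
  by rewrite (le_trans (enorm_le_norm _))// ler_wpM2l// xB// lexx ltW.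
pose K := A + n%:R * B + n%:R * B.
have K0 : 0 <= K by rewrite addr_ge0.
apply: (@abs_continuous_dominated _ _ _ _ _ x _ (K * n%:R) 0) => //.
- by rewrite mulr_ge0.
- exact: xac.
move=> t u t0 tu uT; rewrite mul0r addr0 -mulrA.
have [xt xu] : enorm (x t) <= n%:R * B /\ enorm (x u) <= n%:R * B.
  by split; rewrite (le_trans (enorm_le_norm _))// ler_wpM2l// xB//; lra.
rewrite (@le_trans _ _ (K * enorm (x u - x t)))//; last first.
  by rewrite ler_wpM2l// enorm_le_norm.
have := Fv (x t) (x u); rewrite -enorm_sqr; set s := enorm _.
have s0 : 0 <= s by exact: enorm_ge0.
have sB : s <= n%:R * B + n%:R * B.
  by rewrite (le_trans (ler_enormB _ _))// lerD.
have := cauchy_schwarz_norm (v (x t)) (x u - x t); rewrite -/s => h1 h2.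
have := vA (x t) => h3.
have h4 : enorm (v (x t)) * s <= (A + n%:R * B) * s.
  by rewrite ler_wpM2r//; lra.
have h5 : s ^+ 2 <= (n%:R * B + n%:R * B) * s by rewrite expr2 ler_wpM2r.
have -> : F (x u) - F (x t) = (F (x u) - F (x t) - dot (v (x t)) (x u - x t)) +
  dot (v (x t)) (x u - x t) by ring.
rewrite (le_trans (ler_normD _ _))// /K; lra.
Qed.

Lemma quadratic_slope F v x (t : R) (l : 'rV[R]_n) : quadratic_expansion F v ->
  is_derive t 1 x l -> has_slope (fun u => F (x u)) t (dot (v (x t)) l).
Proof. by move=> Fv; apply: (@has_slope_comp _ _ _ _ _ _ _ 2^-1). Qed.

Definition half_sqnorm p := 2^-1 * dot p p.

Lemma half_sqnorm_expansion c :
  quadratic_expansion (fun p => half_sqnorm (p - c)) (fun p => p - c).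
Proof.
move=> p q; rewrite /half_sqnorm.
have -> : q - c = (q - p) + (p - c) by rewrite subrKA.
rewrite dotDD (dotC (q - p)).
rewrite (_ : _ - _ - _ = 2^-1 * dot (q - p) (q - p)); last by field.
by rewrite ger0_norm// mulr_ge0// dot_ge0.
Qed.

(** The velocity [h - x] points from [x] towards a point of the ball, so the
    distance from [x] to the ball does not increase, and it is 0 at time 0. *)
Lemma bounded_drift x (P : R -> Prop) (B : R) : locally_abs_continuous x ->
  {ae @lebesgue_measure R, forall t, P t} ->
  enorm (x 0) <= B ->
  (forall t, 0 < t -> P t ->
    exists2 h, enorm h <= B & is_derive t 1 x (h - x t)) ->
  forall t, 0 <= t -> enorm (x t) <= B.
Proof.
move=> xac aeP x0 xP t t0.
have B0 : 0 <= B := le_trans (enorm_ge0 _) x0.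
pose K := [set p : 'rV[R]_n | dot (p - 0) (p - 0) <= B ^+ 2].
have KE p : K p <-> enorm p <= B by rewrite enorm_le// /K/= subr0.
have Kcl : closed K by exact: closed_dot_ball.
have Kcv : convex_set K by exact: convex_dot_ball.
have Kx0 : K (x 0) by apply/KE.
have K0 : K !=set0 by exists (x 0).
have Dexp := half_sqdist_expansion Kcl Kcv K0.
have : half_sqdist K (x t) - half_sqdist K (x 0) <= 0 * (t - 0).
  apply: (@slope_bound (fun u => half_sqdist K (x u)) P) => //.
    apply: (@locally_abs_continuous_comp _ _ _ 0 Dexp) => // p.
    rewrite add0r.
    have K00 : K 0 by apply/KE; rewrite enorm_le// dot0l sqr_ge0.
    by have := (proj_spec Kcl K0 p).2 _ K00; rewrite subr0.
  move=> u u0 ut /(xP u u0)[h /KE Kh xh]; eexists; last first.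
    exact: (quadratic_slope Dexp xh).
  have := proj_obtuse Kcl Kcv K0 (x u) Kh.
  have := dot_ge0 (x u - proj K (x u)).
  have -> : h - x u = (h - proj K (x u)) - (x u - proj K (x u)).
    by rewrite opprB addrA subrK.
  rewrite (dotBr _ (h - _)); lra.
have := half_sqdist_le Kcl K0 (x 0) Kx0; rewrite subrr dot0l mulr0 mul0r => D0 Dt.
have : dot (x t - proj K (x t)) (x t - proj K (x t)) <= 0.
  have : half_sqdist K (x t) <= 0 by lra.
  by rewrite /half_sqdist pmulr_rle0.
rewrite le_eqVlt ltNge dot_ge0 orbF dot_eq0 subr_eq0 => /eqP ->.
by apply/KE; exact: proj_in.
Qed.

(** The scalar estimate is applied to the component of [x] along the increment
    [x u - x t]. *)
Lemma bounded_derivative_lipschitz x (P : R -> Prop) (K : R) : 0 <= K ->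
  locally_abs_continuous x ->
  {ae @lebesgue_measure R, forall t, P t} ->
  (forall t, 0 < t -> P t -> exists2 l, enorm l <= K & is_derive t 1 x l) ->
  forall t u, 0 <= t -> t <= u -> enorm (x u - x t) <= K * (u - t).
Proof.
move=> K0 xac aeP xP t u t0 tu.
pose e := x u - x t.
have Fexp : quadratic_expansion (dot e) (fun=> e).
  by move=> p q; rewrite -dotBr subrr normr0 mulr_ge0// dot_ge0.
have : dot e (x u) - dot e (x t) <= (enorm e * K) * (u - t).
  apply: (@slope_bound (fun u => dot e (x u)) P) => //.
    apply: (@locally_abs_continuous_comp _ _ _ (enorm e) Fexp) => // p.
    by rewrite lerDl enorm_ge0.
  move=> r tr _ Pr; have [l lK xl] := xP r (le_lt_trans t0 tr) Pr.
  exists (dot e l); last exact: (quadratic_slope Fexp xl).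
  by rewrite (le_trans (cauchy_schwarz _ _))// ler_wpM2l// enorm_ge0.
rewrite -dotBr -/e -enorm_sqr -mulrA.
have [e0|e0] := eqVneq (enorm e) 0.
  by move=> _; rewrite e0 mulr_ge0// subr_ge0.
by rewrite expr2 ler_pM2l// lt_def e0 enorm_ge0.
Qed.


End Trajectories.

(** A limit point of points that carry larger and larger gradients would
    contradict local boundedness. *)
Lemma clarke_gradient_bounded (R : realType) n (U Omega : set 'rV[R]_n) f
    (M : R) : open U -> locally_lipschitz_on U f -> closed Omega ->
  Omega `<=` U -> exists K, forall p g, Omega p -> enorm p <= M ->
    clarke_gradient f p g -> enorm g <= K.
Proof.
move=> Uo fL Ocl OU; apply: contrapT => nK.
have /choice[pg pgP] : forall k : nat, exists pg : 'rV[R]_n * 'rV[R]_n,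
    [/\ Omega pg.1, enorm pg.1 <= M, clarke_gradient f pg.1 pg.2 &
        k%:R < enorm pg.2].
  move=> k; apply: contrapT => nk; apply: nK; exists k%:R => p g Op pM fg.
  by rewrite leNgt; apply/negP => gk; apply: nk; exists (p, g).
have [G [UG oG]] := nat_ultrafilter.
have [p pP] : exists p : 'rV[R]_n, (pg k).1 @[k --> G] --> p.
  by apply: (@bounded_ultra_cvg _ _ G UG _ M) => k; have [] := pgP k.
have Op : Omega p.
  by apply: (closed_cvg _ Ocl _ _ pP); apply: filterE => k; have [] := pgP k.
have [L pL] := clarke_gradient_locally_bounded Uo fL (OU _ Op).
have GL : G [set k | forall g, clarke_gradient f (pg k).1 g -> enorm g <= L].
  exact: pP pL.
have [k [kL Lk]] := filter_ex (filterI GL (oG _ (nbhs_infty_ger L))).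
have [_ _ fg kg] := pgP k.
by have := kL _ fg; rewrite leNgt => /negP; apply; apply: le_lt_trans kg.
Qed.

(** * Convergence of the algorithm *)

Section Dynamics.
Variables (R : realType) (N n : nat) (U Omega : 'I_N -> set 'rV[R]_n).
Variables (f : 'I_N -> 'rV[R]_n -> R) (d : 'I_N -> 'rV[R]_n) (omega : R).
Variables (a : 'M[R]_N) (lambda2 k1 k2 k3 : R).
Hypothesis N_gt0 : (0 < N)%N.
Hypothesis Omega_closed : forall i, closed (Omega i).
Hypothesis Omega_convex : forall i, convex_set (Omega i).
Hypothesis U_open : forall i, open (U i).
Hypothesis OmegaU : forall i, Omega i `<=` U i.
Hypothesis f_lipschitz : forall i, locally_lipschitz_on (U i) (f i).
Hypothesis omega_gt0 : 0 < omega.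
Hypothesis f_strong : forall i, strongly_convex_on (Omega i) omega (f i).
Hypothesis a_ge0 : forall i j, 0 <= a i j.
Hypothesis a_undirected : undirected a.
Hypothesis a_connected : connected_graph a.
Hypothesis hlambda2 : smallest_positive_eigenvalue (laplacian a) lambda2.
Hypothesis hk1 : spectral_norm (laplacian a) ^+ 2 / (lambda2 ^+ 2 * omega) < k1.
Hypothesis hk2 : k1 ^+ 2 * spectral_norm (laplacian a) ^+ 2 / lambda2 ^+ 3 < k2.
Hypothesis hk3 : 0 < k3.

Variables (ys gs ws : 'I_N -> 'rV[R]_n) (lam : 'rV[R]_n).
Hypothesis Oys : forall i, Omega i (ys i).
Hypothesis gs_clarke : forall i, clarke_gradient (f i) (ys i) (gs i).
Hypothesis gs_normal : forall i q, Omega i q -> 0 <= dot (gs i - lam) (q - ys i).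
Hypothesis ws_balance : forall i, diffuse a ws i = ys i - d i.

Variables (x s w : 'I_N -> R -> 'rV[R]_n).
Hypothesis sol : caratheodory_solution f Omega d a k1 k2 k3 x s w.

Let y i t := output Omega x i t.

Let O0 i : Omega i !=set0. Proof. by exists (ys i). Qed.

Let Oy i t : Omega i (y i t). Proof. exact: proj_in. Qed.

(** The terms in [x i] form a function with gradient [y i - ys i].  The weight of
    [w i] is chosen so that [2 * omega] multiplies the cross term of
    [diffuse (w - ws)] and [y - ys], which leaves room on both sides when
    squares are completed. *)
Definition lyapunov t := \sum_i
  (half_sqnorm (x i t - ys i) + -1 * half_sqdist (Omega i) (x i t) +
   k1^-1 * half_sqnorm (s i t - lam) +
   2 * omega / k3 * half_sqnorm (w i t - ws i)).

Lemma lyapunov_abs_continuous : locally_abs_continuous lyapunov.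
Proof.
have [xac sac wac _] := sol.
have sq_ac (z : R -> 'rV[R]_n) c : locally_abs_continuous z ->
    locally_abs_continuous (fun t => half_sqnorm (z t - c)).
  apply: (locally_abs_continuous_comp (A := enorm c) (half_sqnorm_expansion c)).
  by move=> p; rewrite [leRHS]addrC ler_enormB.
apply: locally_abs_continuous_sum => i.
apply: (@locally_abs_continuousD _ (fun t => half_sqnorm (x i t - ys i) +
  -1 * half_sqdist (Omega i) (x i t) + k1^-1 * half_sqnorm (s i t - lam))).
  apply: (@locally_abs_continuousD _ (fun t => half_sqnorm (x i t - ys i) +
    -1 * half_sqdist (Omega i) (x i t))).
    apply: (@locally_abs_continuousD _ (fun t => half_sqnorm (x i t - ys i))).
      exact: sq_ac.
    apply: locally_abs_continuousZ.
    apply: (locally_abs_continuous_comp (A := enorm (ys i))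
      (half_sqdist_expansion (@Omega_closed i) (@Omega_convex i) (O0 i))) => //.
    move=> p; rewrite (le_trans ((proj_spec (@Omega_closed i) (O0 i) p).2 _ (Oys i)))//.
    by rewrite [leRHS]addrC ler_enormB.
  exact/locally_abs_continuousZ/sq_ac.
exact/locally_abs_continuousZ/sq_ac.
Qed.

(** The part of the energy that depends on [x i] controls the error of the
    output, because the segment from [y i t] to [ys i] makes an obtuse angle
    with [x i t - y i t]. *)
Lemma output_energy i t : 2^-1 * dot (y i t - ys i) (y i t - ys i) <=
  half_sqnorm (x i t - ys i) + -1 * half_sqdist (Omega i) (x i t).
Proof.
have := proj_obtuse (@Omega_closed i) (@Omega_convex i) (O0 i) (x i t) (Oys i).
rewrite /half_sqdist /half_sqnorm -/(output Omega x i t) -/(y i t).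
rewrite -(opprB (y i t) (ys i)) dotNr.
have -> : x i t - ys i = (x i t - y i t) + (y i t - ys i) by rewrite subrKA.
rewrite (dotDD (x i t - y i t)); lra.
Qed.

Lemma lyapunov_ge i t :
  [/\ 0 <= lyapunov t, dot (y i t - ys i) (y i t - ys i) <= 2 * lyapunov t &
      dot (s i t - lam) (s i t - lam) <= 2 * k1 * lyapunov t].
Proof.
have [k10 _] := gains a_undirected hlambda2 omega_gt0 hk1 hk2.
have sq0 (p : 'rV[R]_n) : 0 <= half_sqnorm p by rewrite mulr_ge0// dot_ge0.
have wk3 : 0 <= 2 * omega / k3 by rewrite ltW// divr_gt0// mulr_gt0.
have k1V : 0 < k1^-1 by rewrite invr_gt0.
pose T j := half_sqnorm (x j t - ys j) + -1 * half_sqdist (Omega j) (x j t) +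
   k1^-1 * half_sqnorm (s j t - lam) +
   2 * omega / k3 * half_sqnorm (w j t - ws j).
have T0 j : 0 <= T j.
  have := output_energy j t; have := dot_ge0 (y j t - ys j).
  have := mulr_ge0 (ltW k1V) (sq0 (s j t - lam)).
  have := mulr_ge0 wk3 (sq0 (w j t - ws j)).
  rewrite /T; lra.
have TV : T i <= lyapunov t.
  rewrite /lyapunov (bigD1 i)//= lerDl sumr_ge0// => j _; exact: T0.
split; first by apply: sumr_ge0 => j _; exact: T0.
- have := output_energy i t; have := mulr_ge0 (ltW k1V) (sq0 (s i t - lam)).
  have := mulr_ge0 wk3 (sq0 (w i t - ws i)); rewrite /T in TV; lra.
- have := output_energy i t; have := dot_ge0 (y i t - ys i).
  have := mulr_ge0 wk3 (sq0 (w i t - ws i)); rewrite /T in TV => h1 h2 h3.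
  have : k1^-1 * half_sqnorm (s i t - lam) <= lyapunov t by lra.
  rewrite ler_pdivrMl// /half_sqnorm; lra.
Qed.

(** Three monotonicity facts add up: [x i t - y i t] is normal to [Omega i] at
    [y i t], [lam - gs i] is normal at [ys i], and the Clarke gradient is
    strongly monotone between these two points. *)
Lemma output_monotone i t g : clarke_gradient (f i) (y i t) g ->
  dot (y i t - ys i) (y i t - x i t - g + s i t) <=
  - omega * dot (y i t - ys i) (y i t - ys i) +
  dot (y i t - ys i) (s i t - lam).
Proof.
move=> yg.
have := proj_obtuse (@Omega_closed i) (@Omega_convex i) (O0 i) (x i t) (Oys i).
rewrite -/(output Omega x i t) -/(y i t) -(opprB (y i t) (ys i)) dotNr dotC.
have := @f_strong i _ _ _ _ (Oy i t) (Oys i) yg (gs_clarke i).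
have := gs_normal (Oy i t); rewrite enorm_sqr (dotC (gs i - lam)).
set v := y i t - ys i.
by rewrite !(dotDr, dotNr); lra.
Qed.

(** The condition that a solution satisfies at almost every time, named so that
    the trajectory estimates can take it as a parameter. *)
Let moves (t : R) := 0 < t -> forall i,
  let r := mismatch d a (w ^~ t) (y ^~ t) in
  [/\ exists2 g, clarke_gradient (f i) (y i t) g &
        is_derive t 1 (x i) (y i t - x i t - g + s i t),
      is_derive t 1 (s i)
        (k1 *: r i + k2 *: \sum_j a i j *: (s j t - s i t)) &
      is_derive t 1 (w i) (k3 *: \sum_j a i j *: (r j - r i))].

Lemma lyapunov_slope (t : R) : 0 < t -> moves t ->
  exists2 l, l <= - (omega / 4) * \sum_i dot (y i t - ys i) (y i t - ys i) &
    has_slope lyapunov t l.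
Proof.
move=> t0 /(_ t0) mt; set r := mismatch d a (w ^~ t) (y ^~ t) in mt.
have /choice[g gP] : forall i, exists g, clarke_gradient (f i) (y i t) g /\
    is_derive t 1 (x i) (y i t - x i t - g + s i t).
  by move=> i; have [[g ? ?] _ _] := mt i; exists g.
pose x' i := y i t - x i t - g i + s i t.
pose s' i := k1 *: r i + k2 *: \sum_j a i j *: (s j t - s i t).
pose w' i := k3 *: \sum_j a i j *: (r j - r i).
pose sd i := s i t - lam; pose wd i := w i t - ws i.
pose yd i := y i t - ys i.
have rE : r = fun i => diffuse a wd i - yd i.
  apply/funext => i; rewrite /r /mismatch diffuseB ws_balance /yd.
  by apply/rowP => k; rewrite !mxE; ring.
exists (\sum_i (dot (x i t - ys i) (x' i) +
    -1 * dot (x i t - proj (Omega i) (x i t)) (x' i) +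
    k1^-1 * dot (sd i) (s' i) + 2 * omega / k3 * dot (wd i) (w' i))); last first.
  apply: has_slope_sum => i; have [_ xi] := gP i; have [_ si wi] := mt i.
  apply: has_slopeD; first apply: has_slopeD; first apply: has_slopeD.
  - exact: (quadratic_slope (half_sqnorm_expansion (ys i)) xi).
  - apply: has_slopeZ.
    exact: (quadratic_slope
      (half_sqdist_expansion (@Omega_closed i) (@Omega_convex i) (O0 i)) xi).
  - exact: has_slopeZ (quadratic_slope (half_sqnorm_expansion lam) si).
  - exact: has_slopeZ (quadratic_slope (half_sqnorm_expansion (ws i)) wi).
have dec := lyapunov_decrease a_ge0 a_undirected a_connected hlambda2 N_gt0
  omega_gt0 hk1 hk2 hk3 (y := yd) (s := sd) (w := wd) (s' := s') (w' := w') _ _.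
have {}dec : \sum_i (dot (yd i) (sd i) + k1^-1 * dot (sd i) (s' i) +
    2 * omega / k3 * dot (wd i) (w' i)) <=
    3 / 4 * omega * \sum_i dot (yd i) (yd i).
  apply: dec => i /=; last by rewrite -rE /w' diffuseN scalerN.
  have -> : diffuse a wd i - yd i = r i by rewrite rE.
  by rewrite /s' diffuseN scalerN diffuseB diffuse_cst subr0.
have xP i : dot (x i t - ys i) (x' i) +
    -1 * dot (x i t - proj (Omega i) (x i t)) (x' i) <=
    - omega * dot (yd i) (yd i) + dot (yd i) (sd i).
  rewrite mulN1r -dotBl opprB addrC subrKA.
  exact: output_monotone (gP i).1.
apply: (@le_trans _ _ (- omega * (\sum_i dot (yd i) (yd i)) +
  \sum_i (dot (yd i) (sd i) + k1^-1 * dot (sd i) (s' i) +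
    2 * omega / k3 * dot (wd i) (w' i)))); last by lra.
rewrite mulr_sumr -big_split/=; apply: ler_sum => i _.
by have := xP i; lra.
Qed.

Lemma ae_moves : {ae @lebesgue_measure R, forall t, moves t}.
Proof. by have [_ _ _] := sol. Qed.

Lemma lyapunov_drop t u c : 0 <= t -> t <= u ->
  (forall v, t < v -> v < u -> c <= \sum_i dot (y i v - ys i) (y i v - ys i)) ->
  lyapunov u - lyapunov t <= - (omega / 4) * c * (u - t).
Proof.
move=> t0 tu yc; apply: (slope_bound lyapunov_abs_continuous ae_moves) => //.
move=> v tv vu mv; have [l lV Vl] := lyapunov_slope (le_lt_trans t0 tv) mv.
exists l => //; rewrite (le_trans lV)// !mulNr lerN2 ler_pM2l ?divr_gt0//.
exact: yc.
Qed.

Lemma lyapunov_nonincreasing t u : 0 <= t -> t <= u -> lyapunov u <= lyapunov t.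
Proof.
move=> t0 tu; rewrite -subr_le0 (le_trans (@lyapunov_drop t u 0 t0 tu _))//.
  by move=> v _ _; apply: sumr_ge0 => i _; exact: dot_ge0.
by rewrite mulr0 mul0r.
Qed.

Lemma output_bounded i : exists B, forall t, 0 <= t -> enorm (y i t) <= B.
Proof.
exists (enorm (ys i) + Num.sqrt (2 * lyapunov 0)) => t t0.
apply: dot_ball_bounded; last exact: sqrtr_ge0.
have [V0 _ _] := lyapunov_ge i 0; have [_ yV _] := lyapunov_ge i t.
rewrite sqr_sqrtr ?mulr_ge0// (le_trans yV)// ler_pM2l//.
exact: lyapunov_nonincreasing.
Qed.

Lemma multiplier_bounded i : exists B, forall t, 0 <= t -> enorm (s i t) <= B.
Proof.
exists (enorm lam + Num.sqrt (2 * k1 * lyapunov 0)) => t t0.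
have [k10 _] := gains a_undirected hlambda2 omega_gt0 hk1 hk2.
apply: dot_ball_bounded; last exact: sqrtr_ge0.
have [V0 _ _] := lyapunov_ge i 0; have [_ _ sV] := lyapunov_ge i t.
have kV : 0 <= 2 * k1 * lyapunov 0 by rewrite !mulr_ge0// ltW.
rewrite sqr_sqrtr// (le_trans sV)// ler_pM2l ?mulr_gt0//.
exact: lyapunov_nonincreasing.
Qed.

(** The equation for [x i] has the form [x' = h - x] with [h] bounded: outputs
    and multipliers are bounded by the Lyapunov function, and the Clarke
    gradients are bounded on bounded sets. *)
Lemma output_lipschitz i : exists2 K, 0 < K &
  forall t u, 0 <= t -> t <= u -> enorm (y i u - y i t) <= K * (u - t).
Proof.
have [xac _ _ _] := sol; have [By yB] := output_bounded i.
have [Bs sB] := multiplier_bounded i.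
have [Bg gB] := clarke_gradient_bounded By (@U_open i) (@f_lipschitz i)
  (@Omega_closed i) (@OmegaU i).
pose B := `|By| + `|Bg| + `|Bs| + enorm (x i 0) + 1.
have By0 := ler_norm By; have Bg0 := ler_norm Bg; have Bs0 := ler_norm Bs.
have drift t : 0 < t -> moves t ->
    exists2 h, enorm h <= B & is_derive t 1 (x i) (h - x i t).
  move=> t0 /(_ t0 i)[[g yg xg] _ _].
  exists (y i t - g + s i t); last first.
    by rewrite (_ : _ - _ = y i t - x i t - g + s i t)//; apply/rowP => k; rewrite !mxE; ring.
  rewrite (le_trans (ler_enormD _ _))//.
  have := ler_enormB (y i t) g; have := yB t (ltW t0); have := sB t (ltW t0).
  have := gB _ _ (Oy i t) (yB t (ltW t0)) yg; have := enorm_ge0 (x i 0).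
  rewrite /B; lra.
have x0B : enorm (x i 0) <= B.
  by rewrite /B; have := normr_ge0 By; have := normr_ge0 Bg; have := normr_ge0 Bs; lra.
have B0 : 0 < B.
  by rewrite ltr_wpDl ?addr_ge0 ?enorm_ge0.
have xB := bounded_drift (xac i) ae_moves x0B drift.
exists (B + B); first by rewrite addr_gt0.
move=> t u t0 tu; rewrite (le_trans (proj_nonexpansive _ _ (O0 i) _ _))//.
apply: (bounded_derivative_lipschitz _ (xac i) ae_moves) => //.
  by rewrite addr_ge0// ltW.
move=> v v0 mv; have [h hB xh] := drift v v0 mv; exists (h - x i v) => //.
by rewrite (le_trans (ler_enormB _ _))// lerD// xB// ltW.
Qed.

(** If the error exceeds [e] at some time, then it exceeds [e / 2] during the
    next [h = e / (2 K)] units of time, which costs at least [c] of the Lyapunov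
    function.  After a time [T] at which it is within [c] of its infimum, this
    cannot happen. *)
Lemma output_cvg i : output Omega x i t @[t --> +oo] --> ys i.
Proof.
have [K K0 yK] := output_lipschitz i.
apply/cvgrPdist_le => e e0.
pose h := e / 2 / K; have h0 : 0 < h by rewrite !divr_gt0.
pose c := omega / 4 * (e / 2) ^+ 2 * h.
have e2 : 0 < e / 2 by rewrite divr_gt0.
have w4 : 0 < omega / 4 by rewrite divr_gt0.
have c0 : 0 < c by rewrite mulr_gt0// mulr_gt0// exprn_gt0.
pose A := [set lyapunov t | t in [set t | 0 <= t]].
have A0 : has_inf A.
  split; first by exists (lyapunov 0), 0 => /=.
  by exists 0 => _ [t /= t0 <-]; have [] := lyapunov_ge i t.
have [_ [T /= T0 <-] VT] := inf_adherent c0 A0.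
exists T; split; first exact: num_real.
move=> t Tt; have t0 : 0 <= t := le_trans T0 (ltW Tt).
rewrite (le_trans (norm_le_enorm _))// enormB -/(y i t) leNgt; apply/negP => ey.
have th : t <= t + h by rewrite lerDl ltW.
have := @lyapunov_drop t (t + h) ((e / 2) ^+ 2) t0 th.
rewrite addrAC subrr add0r => drop.
have {}drop : lyapunov (t + h) - lyapunov t <= - c.
  rewrite /c -mulNr -mulNr; apply: drop => v tv vt.
  apply: (@le_trans _ _ (dot (y i v - ys i) (y i v - ys i))); last first.
    by rewrite [leRHS](bigD1 i)//= lerDl sumr_ge0// => j _; exact: dot_ge0.
  rewrite -enorm_sqr ler_sqr ?nnegrE ?enorm_ge0 ?divr_ge0 ?(ltW e0)//.
  have vth : v - t <= h by lra.
  have := yK t v t0 (ltW tv).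
  have : K * (v - t) <= e / 2 by rewrite -ler_pdivlMl// mulrC.
  have := ler_enormB (y i v - ys i) (y i v - y i t).
  by rewrite opprB addrC subrKA; lra.
have : inf A <= lyapunov (t + h).
  by apply: (ge_inf A0.2); exists (t + h); rewrite //= addr_ge0// ltW.
by have := lyapunov_nonincreasing T0 (ltW Tt); lra.
Qed.

End Dynamics.

Theorem theorem5 (R : realType) (N n : nat) (hN : (2 <= N)%N)
  (U Omega : 'I_N -> set 'rV[R]_n) (f : 'I_N -> 'rV[R]_n -> R)
  (d : 'I_N -> 'rV[R]_n)
  (Omega_closed : forall i, closed (Omega i))
  (Omega_convex : forall i, convex_set (Omega i))
  (U_open : forall i, open (U i))
  (U_convex : forall i, convex_set (U i))
  (OmegaU : forall i, Omega i `<=` U i)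
  (f_convex : forall i, convex_function (U i) (f i))
  (f_lipschitz : forall i, locally_lipschitz_on (U i) (f i))
  (hslater : slater Omega d)
  (omega : R) (omega_gt0 : 0 < omega)
  (f_strong : forall i, strongly_convex_on (Omega i) omega (f i))
  (a : 'M[R]_N)
  (a_ge0 : forall i j, 0 <= a i j)
  (a_undirected : undirected a)
  (a_connected : connected_graph a)
  (lambda2 : R)
  (hlambda2 : smallest_positive_eigenvalue (laplacian a) lambda2)
  (k1 k2 k3 : R)
  (hk1 : spectral_norm (laplacian a) ^+ 2 / (lambda2 ^+ 2 * omega) < k1)
  (hk2 : k1 ^+ 2 * spectral_norm (laplacian a) ^+ 2 / lambda2 ^+ 3 < k2)
  (hk3 : 0 < k3) :
  exists ystar : 'I_N -> 'rV[R]_n,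
    [/\ optimal f Omega d ystar,
        forall z, optimal f Omega d z -> z = ystar &
        forall x s w : 'I_N -> R -> 'rV[R]_n,
          caratheodory_solution f Omega d a k1 k2 k3 x s w ->
          forall i, output Omega x i t @[t --> +oo] --> ystar i].
Proof.
have N_gt0 : (0 < N)%N by exact: ltn_trans hN.
have [y [lam [g [yf gy gn]]]] := kkt_exists Omega_closed Omega_convex U_open
  OmegaU f_convex f_lipschitz hslater omega_gt0 f_strong.
have [yopt yuniq] := kkt_optimal Omega_convex U_open OmegaU f_convex f_lipschitz
  omega_gt0 f_strong yf gy gn.
exists y; split=> // x s w sol.
have [yd Oy] := yf.
have [ws wsP] : exists ws, forall i, diffuse a ws i = y i - d i.
  by apply: diffuse_surj => //; rewrite sumrB yd subrr.
have gc i : clarke_gradient (f i) (y i) (g i).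
  apply: subgradient_clarke (gy i); apply: open_nbhs_nbhs.
  by split; [exact: U_open | exact: OmegaU].
exact: (output_cvg N_gt0 Omega_closed Omega_convex U_open OmegaU f_lipschitz
  omega_gt0 f_strong a_ge0 a_undirected a_connected hlambda2 hk1 hk2 hk3 Oy gc
  gn wsP sol).
Qed.
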